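(* Let $\sigma=\{\sigma_i \mid i\in I\}$ be a partition of the set of all primes and let $G$ be a finite $\sigma$-soluble group. Then the following statements are equivalent: (i) Every complete Hall $\sigma$-set of $G$ forms a $\sigma$-basis of $G$. (ii) For every chief factor $H/K$ of $G$, with $\sigma(H/K)=\{\sigma_i\}$, the automorphism group $G/C_{G}(H/K)$ induced by $G$ on $H/K$ is either a $\sigma_{j}$-group or a $\sigma_{i}\cup\sigma_{j}$-group for some $j\neq i$. (iii) $G\simeq G^{*}/R$ for some group $G^{*}$ and normal subgroup $R$ of $G^{*}$, where $G^{*}\leq A_{1}\times\cdots\times A_{t}$ for some $\sigma$-biprimary $\sigma$-soluble groups $A_{1},\ldots,A_{t}$.
   Context: All groups are finite. $\sigma=\{\sigma_i\mid i\in I\}$ is a partition of the set of all primes. For a positive integer $n$, $\pi(n)$ is the set of primes dividing $n$ and $\sigma(n)=\{\sigma_i \mid \sigma_i\cap\pi(n)\neq\emptyset\}$; for a group $G$, $\sigma(G)=\sigma(|G|)$. $G$ is $\sigma$-soluble if $|\sigma(H/K)|=1$ for every chief factor $H/K$ of $G$. A group $A$ is $\sigma$-biprimary if $|\sigma(A)|=2$. A set $\mathcal{H}$ of subgroups of $G$ is a complete Hall $\sigma$-set of $G$ if every member $\neq 1$ of $\mathcal{H}$ is a Hall $\sigma_i$-subgroup of $G$ for some $\sigma_i\in\sigma$, and $\mathcal{H}$ contains exactly one Hall $\sigma_i$-subgroup of $G$ for every $\sigma_i\in\sigma(G)$. A complete Hall $\sigma$-set $\mathcal{H}$ of $G$ is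 a $\sigma$-basis of $G$ if $AB=BA$ for all $A,B\in\mathcal{H}$. For a chief factor $H/K$, $C_G(H/K)$ is the kernel of the conjugation action of $G$ on $H/K$. For a set of primes $\pi$, a $\pi$-group is a group whose order is divisible only by primes in $\pi$ (the trivial group is a $\pi$-group).
   Formalization: The partition σ is additionally assumed to have at least two classes; if σ has a single class, then for every G ≠ 1 statement (i) holds while (ii) and (iii) fail, since no j ≠ i and no σ-biprimary group exists. *)

(* Defs.v *)
From HB Require Import structures.
From mathcomp Require Import all_boot all_fingroup all_solvable.

Set Implicit Arguments.
Unset Strict Implicit.
Unset Printing Implicit Defensive.

Import GroupScope.

(* The indexing of a partition is injective: the classes are nonempty and
   pairwise disjoint, so distinct indices denote distinct classes. *)
Definition prime_partition (I : Type) (sigma : I -> nat_pred) : Prop :=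
  [/\ forall i p, p \in sigma i -> prime p,
      forall i, exists p, p \in sigma i
    & forall p, prime p -> exists! i, p \in sigma i].

Section Sigma.

Variables (I : Type) (sigma : I -> nat_pred).

(* The set sigma(n), as a predicate on the indices of the classes. *)
Definition sigma_of (n : nat) (i : I) : Prop :=
  exists2 p, p \in sigma i & p \in \pi(n).

Section OneGroup.

Variable gT : finGroupType.
Implicit Types (G H K A B : {group gT}) (S : {set {group gT}}).

Definition sigma_soluble G : Prop :=
  forall H K, chief_factor G K H ->
    exists i, forall j, sigma_of #|H / K| j <-> j = i.

Definition sigma_biprimary A : Prop :=
  exists i j, i <> j /\ forall k, sigma_of #|A| k <-> k = i \/ k = j.

(* The trivial subgroup is allowed as an extra member of S. *)
Definition complete_Hall_sigma_set G S : Prop :=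
  [/\ forall A, A \in S -> A \subset G,
      forall A, A \in S -> A :!=: 1 -> exists i, (sigma i).-Hall(G) A
    & forall i, sigma_of #|G| i ->
        exists! A, A \in S /\ (sigma i).-Hall(G) A].

Definition sigma_basis G S : Prop :=
  complete_Hall_sigma_set G S /\
  forall A B, A \in S -> B \in S -> A * B = B * A.

(* 'C_G(H / K | 'Q) is the kernel of the conjugation action of G on H / K. *)
Definition chief_automizers_sigma_bounded G : Prop :=
  forall H K, chief_factor G K H ->
  forall i, (forall k, sigma_of #|H / K| k <-> k = i) ->
  exists j, j <> i /\
    ((sigma j).-group (G / 'C_G(H / K | 'Q)) \/
     [predU sigma i & sigma j].-group (G / 'C_G(H / K | 'Q))).

End OneGroup.

(* setXn A is the direct product of the groups A i, which may live in
   different ambient types. *)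
Definition section_of_biprimary_product (gT : finGroupType) (G : {group gT}) :
    Prop :=
  exists (t : nat) (aT : 'I_t -> finGroupType) (A : forall i, {group aT i})
         (Gstar R : {group {dffun forall i, aT i}}),
    [/\ 0 < t,
        forall i, sigma_biprimary (A i) /\ sigma_soluble (A i),
        Gstar \subset setXn A,
        R <| Gstar
      & G \isog Gstar / R].

End Sigma.

(* Main.v *)
(** Without the odd order theorem, Hall sigma_i-subgroups of a sigma-soluble
    group exist but cannot be shown to be conjugate, so only existence is used.

    (i) => (ii).  By (i), Hall subgroups for distinct classes always permute,
    and this passes to quotients, so the chief factor may be taken to be a
    minimal normal sigma_i-subgroup N.  Put C = C_G(N), let R/C be the largest
    normal sigma_i-subgroup of G/C, let L/R be a chief factor of G, a
    sigma_a-group, and let Z be the intersection of L with a Hall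
    sigma_a-subgroup A.  A Hall sigma_b-subgroup B, b different from a and i,
    permutes with A, hence normalises ZC, and so does its normal closure E.
    If B does not centralise N, then either N is not abelian, N <= E normalises
    ZC, and [N, Z] <= N :&: ZC = 1; or N is abelian, the conjugacy of the
    complements of N in NAB gives N = C_N(A) C_N(B), so [N, E] <= C_N(Z) and
    again Z centralises N.  But Z is not contained in C.

    (ii) => (iii).  Groups covered by residually biprimary groups are closed
    under subdirect products, so one may assume O_{sigma_i'}(G) = 1.  Then
    C_G(F) <= F for F = O_{sigma_i}(G), and (ii), applied to the chief factors
    below F, shows that the subgroups D_j generated by the sigma_j-elements,
    j <> i, are sigma_i :|: sigma_j-groups that commute with each other.  Since
    G is the product of the D_j and of a Hall sigma_i-subgroup Y, it is a
    quotient of a subgroup of the product of the biprimary groups D_j Y.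

    (iii) => (i).  If G* is residually biprimary and X, Y are Hall subgroups of
    G* for the classes i and j, every biprimary image of <X, Y> is a
    sigma_i :|: sigma_j-group, so <X, Y> is one and has order |X||Y|.  Hall
    subgroups of G*/R lift to Hall subgroups of G*. *)

Require Import Defs.
From HB Require Import structures.
From mathcomp Require Import all_boot all_fingroup all_solvable zmodp.
Import GroupScope.

Set Implicit Arguments.
Unset Strict Implicit.
Unset Printing Implicit Defensive.

(** * Separable groups and their Hall subgroups *)

Lemma chief_factor_exists (gT : finGroupType) (G M : {group gT}) :
  M <| G -> M :!=: 1 -> exists K : {group gT}, chief_factor G K M.
Proof.
move=> nsMG ntM; pose Q (K : {group gT}) := (K \proper M) && (G \subset 'N(K)).
have: Q 1%G by rewrite /Q proper1G ntM norms1.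
by case/maxgroup_exists=> K maxK _; exists K;
  rewrite /chief_factor /maxnormal maxK.
Qed.

Section SigmaSeparable.

Variables (I : Type) (sigma : I -> nat_pred).

(* Equivalent to sigma_soluble, but visibly inherited by subgroups. *)
Definition sigma_separable (gT : finGroupType) (G : {group gT}) : Prop :=
  forall H : {group gT}, H \subset G -> H :!=: 1 ->
  exists2 N : {group gT}, N <| H /\ N :!=: H &
    exists i, (sigma i).-nat #|H : N|.

Lemma sigma_separableS (gT : finGroupType) (G H : {group gT}) :
  H \subset G -> sigma_separable G -> sigma_separable H.
Proof. by move=> sHG sepG K sKH; apply: sepG (subset_trans sKH sHG). Qed.

Lemma pgroup_sigma_separable (gT : finGroupType) (G : {group gT}) i :
  (sigma i).-group G -> sigma_separable G.
Proof.
move=> iG H sHG ntH; exists 1%G.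
  by split; [exact: normal1 | rewrite eq_sym].
by exists i; rewrite indexg1; apply: pgroupS sHG iG.
Qed.

(** Among the subgroups of [G] mapping onto [H] a minimal one is chosen: none of its proper
    subgroups maps onto [H], so the proper normal subgroup found in it has a proper image. *)
Lemma morphim_sigma_separable (gT rT : finGroupType) (D G : {group gT})
    (f : {morphism D >-> rT}) :
  G \subset D -> sigma_separable G -> sigma_separable (f @* G).
Proof.
move=> sGD sepG H sHfG ntH.
pose P (U : {group gT}) := (U \subset G) && (f @* U == H).
have: P (G :&: f @*^-1 H)%G.
  by rewrite /P subsetIl /= morphim_setIpre eqEsubset subsetIr subsetI sHfG /=.
case/mingroup_exists=> H0 /mingroupP[/andP[sH0G /eqP fH0] minH0] _.
have sH0D := subset_trans sH0G sGD.
have ntH0: H0 :!=: 1.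
  by apply: contraNneq ntH => H01; rewrite -fH0 H01 morphim1.
have [N [nsNH0 neN] [i iN]] := sepG H0 sH0G ntH0.
exists (f @* N)%G; last first.
  exists i; rewrite /= -fH0; apply: pnat_dvd iN.
  by apply: index_morphim; rewrite subIset ?sH0D.
split; first by rewrite -fH0 morphim_normal.
apply: contraNneq neN => fN; apply/eqP/minH0; last exact: normal_sub.
by rewrite /P (subset_trans (normal_sub nsNH0)) //=; apply/eqP.
Qed.

Lemma quotient_sigma_separable (gT : finGroupType) (G N : {group gT}) :
  G \subset 'N(N) -> sigma_separable G -> sigma_separable (G / N)%G.
Proof. exact: morphim_sigma_separable. Qed.

Lemma residually_sigma_separable (gT : finGroupType) (G : {group gT}) :
  (forall x, x \in G -> x != 1 ->
     exists (rT : finGroupType) (f : {morphism G >-> rT}),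
       f x != 1 /\ sigma_separable (f @* G)) ->
  sigma_separable G.
Proof.
move=> resG H sHG /trivgPn[x xH ntx].
have xG := subsetP sHG x xH.
have [rT [f [ntfx sepfG]]] := resG x xG ntx.
have ntfH: f @* H != 1.
  by apply/trivgPn; exists (f x); rewrite ?mem_morphim.
have [N [/andP[sNH nNH] neN] [i iN]] := sepfG _ (morphimS f sHG) ntfH.
have sHf: H \subset f @*^-1 (f @* H) by rewrite -sub_morphim_pre.
have nNf : f @*^-1 (f @* H) \subset 'N(f @*^-1 N).
  exact: subset_trans (morphpreS _ nNH) (morphpre_norm _ _).
exists (H :&: f @*^-1 N)%G; last first.
  exists i; rewrite /= indexgI -card_quotient ?(subset_trans sHf) //.
  apply: pnat_dvd (cardSg (quotientS _ sHf)) _.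
  by rewrite card_quotient // index_morphpre // morphimS.
split; first by rewrite /normal subsetIl normsI ?normG // (subset_trans sHf).
apply: contraNneq neN => defH; rewrite eqEsubset sNH /= -defH.
by rewrite morphim_setIpre subsetIr.
Qed.

(** Let [M] be minimal among the normal subgroups of [G] containing [H], and [M / K] a chief factor.
    By minimality [H] is not inside [K], and the index of [H :&: K] in [H] divides the order of
    [M / K], which involves one class only. *)
Lemma sigma_soluble_separable (gT : finGroupType) (G : {group gT}) :
  (forall i p, p \in sigma i -> prime p) ->
  (forall p, prime p -> exists i, p \in sigma i) ->
  sigma_soluble sigma G -> sigma_separable G.
Proof.
move=> sigP sigE solG H sHG ntH.
pose P (M : {group gT}) := (M <| G) && (H \subset M).
have: P G by rewrite /P normal_refl.
case/mingroup_exists=> M /mingroupP[/andP[nsMG sHM] minM] _.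
have ntM: M :!=: 1 by apply: contraNneq ntH => M1; rewrite -subG1 -M1.
have [K chKM] := chief_factor_exists nsMG ntM.
have /andP[/maxgroupp/andP[pKM nKG] _] := chKM; have sKM := proper_sub pKM.
have nKM := subset_trans (normal_sub nsMG) nKG.
have nKH := subset_trans sHM nKM.
have [i iMK] := solG M K chKM.
have iM: (sigma i).-group (M / K).
  apply/pgroupP=> p pr_p pM; have [j pj] := sigE p pr_p.
  suff <-: j = i by [].
  by apply/iMK; exists p; rewrite // mem_primes pr_p pM cardG_gt0.
exists (H :&: K)%G; last first.
  exists i; rewrite /= indexgI -card_quotient //.
  by apply: pgroupS iM; apply: quotientS.
split; first by rewrite /normal subsetIl normsI ?normG.
apply/negP=> /eqP defH.
have sHK : H \subset K by rewrite -defH subsetIr.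
have pK : P K.
  by rewrite /P sHK /normal nKG (subset_trans sKM) ?normal_sub.
by have:= minM K pK sKM => eqK; rewrite -eqK properxx in pKM.
Qed.

End SigmaSeparable.

(** * Cores and Hall subgroups for the classes of a partition *)

Section SigmaPartition.

Variables (I : Type) (sigma : I -> nat_pred).
Hypothesis sigma_part : prime_partition sigma.

Lemma sigma_prime i p : p \in sigma i -> prime p.
Proof. by case: sigma_part => + _ _; apply. Qed.

Lemma sigma_witness i : exists p, p \in sigma i.
Proof. by case: sigma_part => _ + _; apply. Qed.

Lemma sigma_cover p : prime p -> exists i, p \in sigma i.
Proof. by case: sigma_part => _ _ uniq_i /uniq_i[i []]; exists i. Qed.

Lemma sigma_inj p i j : p \in sigma i -> p \in sigma j -> i = j.
Proof.
case: sigma_part => _ _ uniq_i pi pj.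
by have [k [_ uk]] := uniq_i p (sigma_prime pi); rewrite -(uk i) // -(uk j).
Qed.

(** [I] is a bare type, but membership of a fixed prime of [sigma i] in [sigma j] is boolean and,
    the classes being disjoint, settles the question. *)
Lemma sigma_eq_dec (i j : I) : i = j \/ i <> j.
Proof.
have [p pi] := sigma_witness i.
have [pj|npj] := boolP (p \in sigma j); first by left; apply: sigma_inj pi pj.
by right=> eqij; rewrite -eqij pi in npj.
Qed.

Lemma sigma_disjoint i j : i <> j -> {subset sigma j <= (sigma i)^'}.
Proof.
by move=> neij p pj; rewrite inE; apply/negP=> /= pi; case: neij;
  apply: sigma_inj pi pj.
Qed.

(** The core of a normal subgroup lies in the core of [G], so the induction descends through normal
    subgroups until the one given by separability is trivial and the group itself belongs to one
    class. *)
Lemma sigma_pcore_neq1 (gT : finGroupType) (G : {group gT}) :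
  sigma_separable sigma G -> G :!=: 1 ->
  exists i, 'O_(sigma i)(G) != 1.
Proof.
have [n] := ubnP #|G|; elim: n G => // n IHn G; rewrite ltnS => leGn sepG ntG.
have [N [nsNG neN] [i iGN]] := sepG G (subxx G) ntG.
have [N1|ntN] := eqVneq (N : {set gT}) 1.
  exists i; rewrite pcore_pgroup_id //.
  by rewrite /pgroup -indexg1 -N1.
have ltNG: N \proper G by rewrite properEneq neN normal_sub.
have [||j ntNj] := IHn N _ _ ntN.
- exact: leq_trans (proper_card ltNG) leGn.
- exact: sigma_separableS (normal_sub nsNG) sepG.
exists j; apply: subG1_contra ntNj; rewrite pcore_max ?pcore_pgroup //.
exact: char_normal_trans (pcore_char _ _) nsNG.
Qed.

Lemma sigma_separable_minnormal (gT : finGroupType) (G N : {group gT}) :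
  sigma_separable sigma N -> minnormal N G -> exists i, (sigma i).-group N.
Proof.
move=> sepN /mingroupP[/andP[ntN nNG] minN].
have [i ntO] := sigma_pcore_neq1 sepN ntN; exists i.
rewrite -(minN 'O_(sigma i)(N)%G) ?pcore_pgroup ?pcore_sub //.
by rewrite ntO (char_norm_trans (pcore_char _ _)).
Qed.

Lemma sigma_separable_chief (gT : finGroupType) (G H K : {group gT}) :
  sigma_separable sigma G -> chief_factor G K H ->
  exists i, (sigma i).-group (H / K).
Proof.
move=> sepG chK; have /andP[/maxgroupp/andP[_ nKG] nsHG] := chK.
have sHG := normal_sub nsHG.
apply: sigma_separable_minnormal (chief_factor_minnormal chK).
apply: quotient_sigma_separable (sigma_separableS sHG sepG).
exact: subset_trans nKG.
Qed.

Lemma sigma_of_pgroup n i :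
  (sigma i).-nat n -> (1 < n)%N -> forall k, sigma_of sigma n k <-> k = i.
Proof.
move=> in_ lt1n k; split=> [[p pk]|->].
  rewrite mem_primes => /and3P[pr_p _ pn].
  by apply: sigma_inj pk _; have /pnatP := in_; apply; rewrite // ltnW.
have pr := pdiv_prime lt1n; exists (pdiv n); last first.
  by rewrite mem_primes pr ltnW // pdiv_dvd.
by have /pnatP := in_; apply; rewrite ?pdiv_dvd // ltnW.
Qed.

Lemma sigma_of_eq_pgroup (gT : finGroupType) (G : {group gT}) i :
  (forall k, sigma_of sigma #|G| k <-> k = i) -> (sigma i).-group G.
Proof.
move=> iG; apply/pgroupP=> p pr_p pG; have [j pj] := sigma_cover pr_p.
suff <-: j = i by [].
by apply/iG; exists p; rewrite // mem_primes pr_p cardG_gt0.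
Qed.

Lemma sigma_separable_soluble (gT : finGroupType) (G : {group gT}) :
  sigma_separable sigma G -> sigma_soluble sigma G.
Proof.
move=> sepG H K chK; have [i iHK] := sigma_separable_chief sepG chK.
exists i; apply: sigma_of_pgroup iHK _.
have /mingroupP[/andP[ntHK _] _] := chief_factor_minnormal chK.
by rewrite cardG_gt1.
Qed.

(** Induction modulo [N], a nontrivial core for a class [a]. Let [X] be the preimage of a Hall
    subgroup of [G / N]. If [a = i] it is a Hall subgroup; otherwise [N] is a normal Hall subgroup
    of [X], and a Schur-Zassenhaus complement serves. *)
Lemma sigma_Hall_exists (gT : finGroupType) (G : {group gT}) i :
  sigma_separable sigma G -> exists X : {group gT}, (sigma i).-Hall(G) X.
Proof.
have [n] := ubnP #|G|; elim: n gT G => // n IHn gT G.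
rewrite ltnS => leGn sepG.
have [G1|ntG] := eqVneq (G : {set gT}) 1.
  by by exists G; rewrite /pHall subxx indexgg G1 pgroup1.
have [a ntN] := sigma_pcore_neq1 sepG ntG.
set N := 'O_(sigma a)(G)%G in ntN.
have nsNG: N <| G := pcore_normal _ _; have nNG := normal_norm nsNG.
have [Xb hallXb]: exists Xb : {group coset_of N}, (sigma i).-Hall(G / N) Xb.
  apply: IHn (quotient_sigma_separable nNG sepG).
  by apply: leq_trans (ltn_quotient ntN (pcore_sub _ _)) leGn.
have [X defX sNX sXG] := inv_quotientS nsNG (pHall_sub hallXb).
rewrite {}defX in hallXb.
have nsNX := normalS sNX sXG nsNG.
have [eqai|neai] := sigma_eq_dec a i.
  exists X; rewrite -(pquotient_pHall _ nsNG nsNX) //.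
  by rewrite -eqai pcore_pgroup.
have i'N: (sigma i)^'.-group N.
  by apply: sub_pgroup (pcore_pgroup _ _); apply: sigma_disjoint => /esym.
have coNX: coprime #|N| #|X : N|.
  rewrite coprime_sym -card_quotient ?normal_norm //.
  exact: pnat_coprime (pHall_pgroup hallXb) i'N.
have /splitsP[Y /complP[tiNY defX]]: [splits X, over N].
  by apply: SchurZassenhaus_split; rewrite // /Hall sNX.
have oNY: (#|N| * #|Y|)%N = #|X| by rewrite -defX TI_cardMg.
have sYX: Y \subset X by rewrite -defX mulG_subr.
have oY : #|Y| = #|X / N|.
  by rewrite card_quotient ?normal_norm // -divgS // -oNY mulKn.
exists Y; apply/and3P; split; first exact: subset_trans sXG.
  by rewrite /pgroup oY; have := pHall_pgroup hallXb.
rewrite -(Lagrange_index sXG sYX) pnatM -(index_quotient_eq _ sXG nNG) //.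
  have /and3P[_ _ ->] := hallXb.
  by rewrite /= -divgS // -oNY mulnK.
by rewrite subIset // sNX orbT.
Qed.

(** The Hall-Higman argument: otherwise a minimal normal subgroup [L / F] of [G / F] lies in
    [C / F], the image of the centraliser, and its class is not [i] because [G / F] has trivial core
    for [sigma i]. *)
Lemma cent_sub_pcore (gT : finGroupType) (G : {group gT}) i :
  sigma_separable sigma G -> 'O_(sigma i)^'(G) = 1 ->
  'C_G('O_(sigma i)(G)) \subset 'O_(sigma i)(G).
Proof.
move=> sepG O1; set F := 'O_(sigma i)(G)%G; set C := 'C_G(F)%G.
have nsFG: F <| G := pcore_normal _ _; have nFG := normal_norm nsFG.
have nsCG: C <| G by apply: norm_normalI; rewrite norms_cent.
rewrite -quotient_sub1; last by rewrite subIset ?nFG.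
apply/idPn=> ntCF; rewrite subG1 in ntCF.
have [||Lb minLb sLbC] := @minnormal_exists _ (G / F) (C / F) _ _ => //.
  by rewrite quotient_norms ?normal_norm.
have sCG := normal_sub nsCG.
have /mingroupP[/andP[ntLb nLbG] _] := minLb.
have sepLb: sigma_separable sigma Lb.
  apply: sigma_separableS (quotient_sigma_separable nFG sepG).
  exact: subset_trans sLbC (quotientS _ sCG).
have [a aLb] := sigma_separable_minnormal sepLb minLb.
have nsLbG: Lb <| G / F.
  by rewrite /normal nLbG (subset_trans sLbC) ?quotientS.
have [eqai|neai] := sigma_eq_dec a i.
  case/negP: ntLb; rewrite -subG1 -(trivg_pcore_quotient (sigma i) G) eqai in
    aLb *.
  exact: pcore_max.
have [L defL sFL sLG] := inv_quotientS nsFG (normal_sub nsLbG).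
have nsLG: L <| G by rewrite -(quotientGK nsFG) -(quotientGK (normalS sFL sLG
  nsFG)) -defL cosetpre_normal.
have i'Lb: (sigma i)^'.-group Lb.
  by apply: sub_pgroup aLb; apply: sigma_disjoint => /esym.
(* [K :&: F] is a normal Hall subgroup of [K] and central in [K], so its complement [X] is normal in
   [K]; hence [X] lies in the trivial [sigma i]-prime core of [G], and [K] lies in [F]. *)
set K := (L :&: C)%G.
have nsKG: K <| G := normalI nsLG nsCG.
have sKC: K \subset C by apply: subsetIr.
have nsKFK: K :&: F <| K by rewrite /normal subsetIl normsI ?normG
  ?(subset_trans _ nFG) ?normal_sub.
have i'K: (sigma i)^'.-nat #|K : K :&: F|.
  rewrite indexgI -card_quotient ?(subset_trans _ nFG) ?normal_sub //.
  by apply: pgroupS i'Lb; rewrite defL quotientS ?subsetIl.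
have iKF: (sigma i).-group (K :&: F).
  by apply: pgroupS (subsetIr _ _) _; apply: pcore_pgroup.
have /splitsP[X /complP[tiX defX]]: [splits K, over K :&: F].
  by apply: SchurZassenhaus_split; rewrite // /Hall subsetIl (pnat_coprime iKF).
have i'X: (sigma i)^'.-group X.
  rewrite /pgroup -(mulKn #|X| (cardG_gt0 (K :&: F)%G)) -TI_cardMg //=.
  by rewrite defX divgS ?subsetIl.
have cX: K :&: F \subset 'C(K).
  by rewrite (subset_trans (subsetIr _ _)) //
    centsC (subset_trans sKC) ?subsetIr.
have nsXK: X <| K.
  have sXK: X \subset K by rewrite -defX mulG_subr.
  rewrite /normal sXK -defX mul_subG ?normG //.
  by rewrite cents_norm // (subset_trans cX) ?centS.
have X1: X :=: 1.
  apply/trivgP; rewrite -O1; apply: subset_trans (pcore_max i'X nsXK) _.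
  by rewrite pcore_max ?pcore_pgroup // (char_normal_trans (pcore_char _ _)).
have sKF: K \subset F by rewrite -defX X1 mulg1 subsetIr.
have nFL := subset_trans sLG nFG.
case/negP: ntLb; rewrite -subG1 defL quotient_sub1 //.
have sLFC: L \subset F * C by rewrite -quotientSK -?defL.
have defLK: F * K = L.
  by rewrite /= setIC group_modl //; apply/setIidPr.
by rewrite -defLK mul_subG.
Qed.

End SigmaPartition.

(** * Permutability of Hall subgroups *)

Section HallPermutable.

Variables (I : Type) (sigma : I -> nat_pred).
Hypothesis sigma_part : prime_partition sigma.

(** Clause (i) read on single pairs. The classes are distinct because a complete Hall set has only
    one member for each class that occurs. *)
Definition Hall_permutable (gT : finGroupType) (G : {group gT}) : Prop :=
  forall i j (X Y : {group gT}), i <> j ->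
  (sigma i).-Hall(G) X -> (sigma j).-Hall(G) Y -> X * Y = Y * X.

(* At most two classes occur, whereas sigma_biprimary asks for exactly two. *)
Definition sub_biprimary (gT : finGroupType) (G : {group gT}) : Prop :=
  sigma_separable sigma G /\
  exists i j, i <> j /\ [predU sigma i & sigma j].-group G.

Definition residually_biprimary (gT : finGroupType) (G : {group gT}) : Prop :=
  forall x, x \in G -> x != 1 ->
  exists (rT : finGroupType) (f : {morphism G >-> rT}),
    f x != 1 /\ sub_biprimary (f @* G).

Lemma residually_biprimary_separable (gT : finGroupType) (G : {group gT}) :
  residually_biprimary G -> sigma_separable sigma G.
Proof.
move=> resG; apply: residually_sigma_separable => x xG ntx.
by have [rT [f [ntfx [sepf _]]]] := resG x xG ntx; exists rT, f.
Qed.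

Lemma residually_Hall_permutable (gT : finGroupType) (G : {group gT}) :
  residually_biprimary G -> Hall_permutable G.
Proof.
move=> resG i j X Y neij hallX hallY.
have [sXG iX i'X] := and3P hallX; have [sYG jY j'Y] := and3P hallY.
pose pi : nat_pred := [predU sigma i & sigma j].
have i_pi p : p \in sigma i -> p \in pi by rewrite inE /= => ->.
have j_pi p : p \in sigma j -> p \in pi by rewrite inE /= orbC => ->.
have sPG : X <*> Y \subset G by rewrite join_subG sXG.
(* By Cauchy's theorem only elements [x] of prime order matter. Such an [x] survives in some image
   with two classes [a] and [b], where [X] or [Y] vanishes if its class is neither of them. *)
have piP : pi.-group (X <*> Y).
  apply/pgroupP=> p pr_p pP; have [x xP ox] := Cauchy pr_p pP.
  have ntx : x != 1 by rewrite -order_gt1 ox prime_gt1.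
  have [rT [f [ntfx [_ [a [b [neab abG]]]]]]] := resG x (subsetP sPG x xP) ntx.
  have sfPG := morphimS f sPG.
  suff pifP : pi.-group (f @* (X <*> Y)).
    have ofx : #[f x] = p.
      apply/(prime_nt_dvdP pr_p); first by rewrite order_eq1.
      by rewrite -ox morph_order ?(subsetP sPG).
    have := mem_p_elt pifP (mem_morphim f (subsetP sPG x xP) xP).
    by rewrite /p_elt ofx pnatE.
  have triv c (Z : {group gT}) : c <> a -> c <> b -> Z \subset G ->
      (sigma c).-group Z -> f @* Z = 1.
    move=> neca necb sZG cZ; apply/eqP; rewrite trivg_card1.
    have cfZ := morphim_pgroup f cZ; have abfZ := pgroupS (morphimS f sZG) abG.
    rewrite (pnat_1 cfZ) //; apply: sub_pgroup abfZ => p' /orP[] /=;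
      apply: sigma_disjoint => //.
  have fXY : f @* (X <*> Y) = f @* X <*> f @* Y by rewrite morphimY.
  have [eqia|neia] := sigma_eq_dec sigma_part i a.
    have [eqjb|nejb] := sigma_eq_dec sigma_part j b.
      by apply: pgroupS sfPG _; rewrite /pi eqia eqjb.
    rewrite fXY (triv j Y) ?joingG1 //; last by rewrite -eqia => /esym.
    by apply: morphim_pgroup; apply: sub_pgroup iX.
  have [eqib|neib] := sigma_eq_dec sigma_part i b; last first.
    rewrite fXY (triv i X) ?joing1G //.
    by apply: morphim_pgroup; apply: sub_pgroup jY.
  have [eqja|neja] := sigma_eq_dec sigma_part j a.
    apply: pgroupS sfPG _; rewrite /pi eqib eqja.
    by apply: sub_pgroup abG => p'; rewrite !inE orbC.
  rewrite fXY (triv j Y) ?joingG1 //; last by rewrite -eqib => /esym.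
  by apply: morphim_pgroup; apply: sub_pgroup iX.
have coXY : coprime #|X| #|Y|.
  by apply: pnat_coprime iX _; apply: sub_pgroup jY; apply: sigma_disjoint.
(* Orders are compared: [X] and [Y] being Hall subgroups, the [sigma i]-part of the order of the
   join divides that of [X], and the remaining part, a [sigma j]-number, divides that of [Y]. *)
have defP : X * Y = X <*> Y.
  apply/eqP; rewrite eqEcard mulG_subG joing_subl joing_subr /=.
  rewrite TI_cardMg ?coprime_TIg //; apply: dvdn_leq;
    first by rewrite muln_gt0 !cardG_gt0.
  have dP : #|X <*> Y| %| #|G| by apply: cardSg.
  rewrite -(partnC (sigma i) (cardG_gt0 (X <*> Y))) dvdn_mul //.
    by rewrite (card_Hall hallX) partn_dvd.
  have jP : (sigma j).-nat (#|X <*> Y|`_(sigma i)^')%N.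
    apply/pnatP=> // p pr_p pP; have /andP[i'p _] : (p \in (sigma i)^') && true.
      by rewrite andbT; have /pnatP := part_pnat (sigma i)^' #|X <*> Y|; apply.
    have := pgroupP piP p pr_p (dvdn_trans pP (dvdn_part _ _)).
    by rewrite inE /= => /orP[pi_|//]; rewrite inE /= pi_ in i'p.
  rewrite (card_Hall hallY) -(part_pnat_id jP) partn_dvd //.
  exact: dvdn_trans (dvdn_part _ _) dP.
by apply/comm_group_setP; rewrite defP groupP.
Qed.

(** Conjugacy is avoided by lifting [X] itself: a Hall subgroup of the full preimage of [X] is a
    Hall subgroup of [G], and its image is a Hall subgroup of [f @* G] inside [X], hence all of
    [X]. *)
Lemma morphim_Hall_permutable (gT rT : finGroupType) (D G : {group gT})
    (f : {morphism D >-> rT}) :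
  G \subset D -> sigma_separable sigma G -> Hall_permutable G ->
  Hall_permutable (f @* G).
Proof.
move=> sGD sepG permG.
have lift i (X : {group rT}) : (sigma i).-Hall(f @* G) X ->
    exists2 X0 : {group gT}, (sigma i).-Hall(G) X0 & f @* X0 = X.
  move=> hallX; have [sXG iX i'X] := and3P hallX.
  pose E := (G :&: f @*^-1 X)%G; have sEG : E \subset G := subsetIl _ _.
  have [X0 hallX0] := sigma_Hall_exists sigma_part i (sigma_separableS sEG
    sepG).
  have sX0E := pHall_sub hallX0; have sX0G := subset_trans sX0E sEG.
  have hallX0G : (sigma i).-Hall(G) X0.
    apply/and3P; split; [by [] | exact: pHall_pgroup hallX0 |].
    rewrite -(Lagrange_index sEG sX0E) pnatM.
    have /and3P[_ _ ->] := hallX0; rewrite andbT.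
    rewrite -(index_morphim_ker f sEG sGD) /= morphim_setIpre (setIidPr sXG).
    have /eqP-> : #|'ker_G f : E| == 1%N.
      by rewrite indexg_eq1 setIS // morphpreS // sub1G.
    by rewrite muln1.
  exists X0 => //; apply/esym/(sub_pHall (morphim_pHall f (subset_trans sX0G
    sGD) hallX0G)) => //.
  rewrite sub_morphim_pre; last exact: subset_trans sX0G sGD.
  exact: subset_trans sX0E (subsetIr _ _).
move=> i j X Y neij /lift[X0 hallX0 <-] /lift[Y0 hallY0 <-].
have sX0D := subset_trans (pHall_sub hallX0) sGD.
have sY0D := subset_trans (pHall_sub hallY0) sGD.
by rewrite -!morphimMl // (permG i j).
Qed.

Lemma Hall_permutable_basis (gT : finGroupType) (G : {group gT})
    (S : {set {group gT}}) :
  Hall_permutable G -> complete_Hall_sigma_set sigma G S ->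
  sigma_basis sigma G S.
Proof.
move=> permG cS; split=> // A B AS BS; have [subS hallS uniqS] := cS.
have [->|ntA] := eqVneq (A : {set gT}) 1; first by rewrite mul1g mulg1.
have [->|ntB] := eqVneq (B : {set gT}) 1; first by rewrite mul1g mulg1.
have [i hallA] := hallS A AS ntA; have [j hallB] := hallS B BS ntB.
have [eqij|neij] := sigma_eq_dec sigma_part i j; last exact: permG hallA hallB.
rewrite -eqij in hallB; suff -> : A = B by [].
have [|C [_ uC]] := uniqS i; last by rewrite -(uC A) // -(uC B).
have pr := pdiv_prime (etrans (cardG_gt1 A) ntA); exists (pdiv #|A|).
  by apply: (pgroupP (pHall_pgroup hallA)); rewrite ?pdiv_dvd.
by rewrite mem_primes pr cardG_gt0 (dvdn_trans (pdiv_dvd _)) ?cardSg ?subS.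
Qed.

(** The classes cannot be enumerated, so the primes dividing the order of [G] are. Starting from [X]
    and [Y], a Hall subgroup is added whenever a prime divides the order of no member so far. *)
Lemma complete_Hall_sigma_set_extend (gT : finGroupType) (G X Y :
  {group gT}) i j :
  sigma_separable sigma G -> i <> j -> X :!=: 1 -> Y :!=: 1 ->
  (sigma i).-Hall(G) X -> (sigma j).-Hall(G) Y ->
  exists S : {set {group gT}},
    [/\ complete_Hall_sigma_set sigma G S, X \in S & Y \in S].
Proof.
move=> sepG neij ntX ntY hallX hallY.
have divP k (A : {group gT}) p : (sigma k).-Hall(G) A -> p \in sigma k ->
    p %| #|G| -> p %| #|A|.
  move=> hallA pk pG; have pr_p := sigma_prime sigma_part pk.
  rewrite -(Lagrange (pHall_sub hallA)) Euclid_dvdM // in pG.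
  have [//|/= pGA] := orP pG; have /and3P[_ _ k'A] := hallA.
  by have := pnatPpi k'A (_ : p \in \pi(_));
    rewrite mem_primes pr_p pGA indexg_gt0 => /(_ isT); rewrite inE /= pk.
have classP k (A : {group gT}) p : (sigma k).-Hall(G) A -> p %| #|A| ->
  prime p -> p \in sigma k.
  by move=> hallA pA pr_p; apply: (pgroupP (pHall_pgroup hallA)).
suff [S [[subS HallS uniqS] XS YS coverS]]: exists S : {set {group gT}},
   [/\ [/\ forall A, A \in S -> A \subset G,
       forall A, A \in S -> A :!=: 1 /\ exists k, (sigma k).-Hall(G) A &
       forall k A B, A \in S -> B \in S -> (sigma k).-Hall(G) A ->
          (sigma k).-Hall(G) B -> A = B], X \in S, Y \in S &
      forall p, p \in primes #|G| -> prime p -> p %| #|G| ->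
        exists2 A, A \in S & p %| #|A|].
  exists S; split=> //; split=> // [A /HallS[]//|k [p pk pG]].
  have pr_p := sigma_prime sigma_part pk.
  have [|A AS pA] := coverS p pG pr_p; first by rewrite mem_primes in pG;
    case/and3P: pG.
  have [_ [l hallA]] := HallS A AS.
  have eqkl := sigma_inj sigma_part pk (classP _ _ _ hallA pA pr_p).
  rewrite -eqkl in hallA.
  by exists A; split=> // B [BS hallB]; apply: uniqS hallB.
elim: (primes #|G|) => [|p ps [S [[subS HallS uniqS] XS YS coverS]]].
  exists [set X; Y]; split; rewrite ?set21 ?set22 //; split=> [A|A|k A B].
  - by case/set2P=> ->; apply: pHall_sub; eassumption.
  - by case/set2P=> ->; split=> //; [exists i | exists j].
  have neXY (k' : I) : (sigma k').-Hall(G) X -> (sigma k').-Hall(G) Y -> False.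
    have neq1 l (Z : {group gT}) : Z :!=: 1 -> (sigma l).-Hall(G) Z ->
        (sigma k').-Hall(G) Z -> k' = l.
      rewrite -cardG_gt1 => /pdiv_prime pr hallZ hallZ'.
      have := pdiv_dvd #|Z|; move/classP=> pZ.
      by apply: (sigma_inj sigma_part); apply: pZ pr; eassumption.
    move=> kX kY; apply: neij.
    exact: etrans (esym (neq1 _ _ ntX hallX kX)) (neq1 _ _ ntY hallY kY).
  case/set2P=> ->; case/set2P=> -> hA hB; [by [] | | | by []].
    by case: (neXY k hA hB).
  by case: (neXY k hB hA).
have [[pr_p pG newp]|oldp] : [/\ prime p, p %| #|G| & forall A, A \in S ->
  ~~ (p %| #|A|)]
     \/ (prime p -> p %| #|G| -> exists2 A, A \in S & p %| #|A|).
- have [/existsP[B /andP[BS pB]]|/existsPn newp] := boolP [exists B,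
  (B \in S) && (p %| #|B|)].
    by right; exists B.
  have [pr_p|] := boolP (prime p); last by right.
  have [pG|] := boolP (p %| #|G|); last by right.
  by left; split=> // B BS; have := newp B; rewrite BS.
- have [k pk] := sigma_cover sigma_part pr_p.
  have [A hallA] := sigma_Hall_exists sigma_part k sepG.
  have pA := divP _ _ _ hallA pk pG.
  have newA l B : B \in S -> (sigma l).-Hall(G) A -> (sigma l).-Hall(G) B ->
    False.
    move=> BS hA hB; have := newp B BS.
    by rewrite (divP l) // (classP l A).
  exists (A |: S); split; rewrite ?inE ?XS ?YS ?orbT //.
    split=> [B|B|l B C]; rewrite ?inE.
    + by case/predU1P=> [->|/subS//]; apply: pHall_sub hallA.
    + case/predU1P=> [->|/HallS//]; split; last by exists k.
      by rewrite -cardG_gt1 (leq_trans (prime_gt1 pr_p)) // dvdn_leq.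
    case/predU1P=> [->|BS] /predU1P[->|CS] // hB hC; last exact: uniqS hB hC.
      by case: (newA l C).
    by case: (newA l B).
  move=> q; rewrite inE => /predU1P[-> _ _|qps pr_q qG].
    by exists A; rewrite ?setU11.
  by have [B BS qB] := coverS q qps pr_q qG; exists B; rewrite ?inE ?BS ?orbT.
exists S; split=> // q; rewrite inE => /predU1P[->|];
  [exact: oldp | exact: coverS].
Qed.

End HallPermutable.

(** * Automizers of chief factors *)

Section Automizers.

Variables (I : Type) (sigma : I -> nat_pred).
Hypothesis sigma_part : prime_partition sigma.

(* AB and AB^n are complements of N in NAB, hence conjugate under N, and the
   conjugating element splits n. *)
Lemma coprime_permutable_cent_mul (gT : finGroupType) (N A B : {group gT}) :
  abelian N -> A \subset 'N(N) -> B \subset 'N(N) ->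
  coprime #|N| #|A| -> coprime #|N| #|B| -> coprime #|A| #|B| ->
  (forall n, n \in N -> A * (B :^ n) = (B :^ n) * A) ->
  N \subset 'C_N(A) * 'C_N(B).
Proof.
move=> abN nNA nNB coNA coNB coAB permAB; apply/subsetP=> n nN.
have WE m : m \in N -> A <*> (B :^ m) = A * (B :^ m).
  by move=> mN; apply: comm_joingE; apply: permAB.
have AB1 : A <*> B = A * B by have := WE 1 (group1 N); rewrite conjsg1.
have oW m : m \in N -> #|A <*> (B :^ m)| = (#|A| * #|B|)%N.
  move=> mN; rewrite WE // TI_cardMg ?cardJg //.
  by apply: coprime_TIg; rewrite cardJg.
have nNW : A <*> B \subset 'N(N) by rewrite join_subG nNA.
have sA_AB : A \subset A <*> B := joing_subl A B.
have sB_AB : B \subset A <*> B := joing_subr A B.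
have tiNW : N :&: (A <*> B) = 1.
  by apply: coprime_TIg; have := oW 1 (group1 N); rewrite conjsg1 /= => ->;
    rewrite coprimeMr coNA.
(* If [x] in [N] conjugates a subgroup [D] of [A <*> B] into [A <*> B], then each [[~ x, d]] lies in
   [N :&: (A <*> B) = 1]. *)
have cN (D : {group gT}) x : D \subset A <*> B -> x \in N ->
    D :^ x \subset A <*> B -> x \in 'C_N(D).
  move=> sDW xN sDxW; rewrite inE xN; apply/centP=> d dD.
  apply/esym/commgP; rewrite -in_set1 -[[set 1]]tiNW inE.
  have dW := subsetP sDW d dD; apply/andP; split.
    by rewrite commgEr groupM // memJ_norm ?groupV // (subsetP nNW).
  by rewrite commgEl groupM ?groupV // (subsetP sDxW) // memJ_conjg.
have sW'NW : A <*> (B :^ n) \subset N * (A <*> B).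
  rewrite -norm_joinEr // join_subG (subset_trans sA_AB) ?joing_subr //=.
  rewrite -(conjGid (subsetP (joing_subl _ _) n nN)) conjSg.
  by rewrite (subset_trans sB_AB) ?joing_subr.
have coNW : coprime #|N| #|A <*> B|.
  by have := oW 1 (group1 N); rewrite conjsg1 => ->; rewrite coprimeMr coNA.
have oWn : #|A <*> (B :^ n)| = #|A <*> B|.
  by rewrite oW // -(oW 1) // conjsg1.
have [x xN defW] := SchurZassenhaus_trans_sol (abelian_sol abN) nNW sW'NW coNW
  oWn.
(* From [A <*> (B :^ n) = (A <*> B) :^ x] it follows that [x^-1] conjugates [A], and [n * x^-1]
   conjugates [B], into [A <*> B]. *)
have CAx : x \in 'C_N(A).
  rewrite -groupV cN ?groupV //.
  by rewrite sub_conjgV -defW joing_subl.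
have CBnx : n * x^-1 \in 'C_N(B).
  rewrite cN ?groupM ?groupV //.
  by rewrite conjsgM sub_conjgV -defW joing_subr.
apply/imset2P; exists x (n * x^-1) => //.
by rewrite (centsP abN n nN) ?groupV // mulKVg.
Qed.

Lemma minnormal_automizer (gT : finGroupType) (G N : {group gT}) i :
  (exists j, j <> i) -> sigma_separable sigma G -> Hall_permutable sigma G ->
  minnormal N G -> N \subset G -> (sigma i).-group N ->
  exists j, j <> i /\ [predU sigma i & sigma j].-nat #|G : 'C_G(N)|.
Proof.
move=> [j0 nej0] sepG permG /mingroupP[/andP[ntN nNG] minN] sNG iN.
pose C := 'C_G(N)%G; have nsNG : N <| G by apply/andP.
have nsCG : C <| G by apply: norm_normalI; rewrite norms_cent.
pose P (R : {group gT}) := [&& R <| G, C \subset R & (sigma i).-nat #|R : C|].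
have : P C by rewrite /P nsCG subxx indexgg.
case/maxgroup_exists=> R /maxgroupP[/and3P[nsRG sCR iRC] maxR] _.
have [eqRG|neRG] := eqVneq (R : {set gT}) G.
  (* Here [G / C] is already a [sigma i]-group, and any other class will do. *)
  exists j0; split=> //; rewrite eqRG in iRC; apply: sub_in_pnat iRC => p _ pi.
  by rewrite inE /= pi.
have [sRG nRG] := andP nsRG; have sCG := normal_sub nsCG.
have [|Lb minLb sLbG] := @minnormal_exists _ (G / R) (G / R) _ (normG _).
  by rewrite -subG1 quotient_sub1 //; apply: contra neRG; rewrite eqEsubset sRG.
have /mingroupP[/andP[ntLb nLbG] _] := minLb.
have [a aLb] : exists a, (sigma a).-group Lb.
  apply: sigma_separable_minnormal minLb => //.
  exact: sigma_separableS sLbG (quotient_sigma_separable nRG sepG).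
have nsLbG : Lb <| G / R by apply/andP.
have [L defL sRL sLG] := inv_quotientS nsRG sLbG.
have nRL := subset_trans sLG nRG; have sCL := subset_trans sCR sRL.
have nsLG : L <| G.
  by rewrite -(quotientGK nsRG) -(quotientGK (normalS sRL sLG nsRG)) -defL
    cosetpre_normal.
have aLR : (sigma a).-nat #|L : R| by rewrite -card_quotient // -defL.
have neLR : ~~ (L \subset R).
  by apply: contra ntLb => sLR; rewrite defL -subG1 quotient_sub1.
have neai : a <> i.
  move=> eqai; case/negP: neLR; rewrite (maxR L) // /P nsLG sCL /=.
  by rewrite -(Lagrange_index sRL sCR) pnatM iRC -eqai aLR.
exists a; split=> //.
have [A hallA] := sigma_Hall_exists sigma_part a sepG.
have [sAG aA _] := and3P hallA.
set Z := (A :&: L)%G; have hallZ : (sigma a).-Hall(L) Z :=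
  Hall_setI_normal nsLG hallA.
have [sZL aZ a'Z] := and3P hallZ; have sZG := subset_trans sZL sLG.
have nZC : ~~ (Z \subset C).
  apply: contra neLR => sZC; rewrite -indexg_eq1.
  rewrite (pnat_1 aLR) //; move: a'Z.
  by rewrite -(Lagrange_index sRL (subset_trans sZC sCR)) pnatM => /andP[].
suff cNB b (B : {group gT}) : b <> i -> b <> a -> (sigma b).-Hall(G) B ->
  B \subset C.
  apply/pnatP; rewrite ?indexg_gt0 // => p pr_p pGC.
  have [b pb] := sigma_cover sigma_part pr_p; rewrite inE /=.
  have [<-|nebi] := sigma_eq_dec sigma_part b i; first by rewrite pb.
  have [<-|neba] := sigma_eq_dec sigma_part b a; first by rewrite pb orbT.
  have [B hallB] := sigma_Hall_exists sigma_part b sepG.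
  have sBC := cNB b B nebi neba hallB; have /and3P[_ _ b'B] := hallB.
  rewrite -(Lagrange_index sCG sBC) pnatM in b'B; have /andP[b'C _] := b'B.
  by have := pnatP _ (indexg_gt0 _ _) b'C p pr_p pGC; rewrite inE /= pb.
move=> nebi neba hallB.
have nCG := normal_norm nsCG.
(* A prime dividing the order of [M / C] divides both [#|A| * #|B'|] and [#|L : R| * #|R : C|], so
   it belongs to [sigma a]. As [Z / C] is a Hall subgroup of [L / C], this gives
   [M <*> C = Z <*> C], and [B'] normalises [M]. *)
have normZC (B' : {group gT}) : (sigma b).-Hall(G) B' -> B' \subset 'N(Z <*> C).
  move=> hallB'; have [sB'G bB' _] := and3P hallB'.
  have defW : A <*> B' = A * B'.
    by apply: comm_joingE; apply: permG hallA hallB' => eqab; case: neba.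
  set W := (A <*> B')%G.
  have sWG : W \subset G by rewrite join_subG sAG.
  set M := (W :&: L)%G; have sMG : M \subset G by rewrite subIset ?sWG.
  have sML : M \subset L := subsetIr _ _.
  have nCM := subset_trans sMG nCG.
  have sZM : Z \subset M by rewrite setSI ?joing_subl.
  have aM : (sigma a).-group (M / C).
    apply/pgroupP=> p pr_p pM.
    have pLC : p %| #|L : C|.
      rewrite -card_quotient ?(subset_trans sLG) //.
      by apply: dvdn_trans pM _; rewrite cardSg ?quotientS.
    have pW : p %| #|A| * #|B'|.
      rewrite (dvdn_trans (dvdn_trans pM (dvdn_quotient _ _))) //.
      rewrite (dvdn_trans (cardSg (subsetIl _ _))) //= defW -TI_cardMg //.
      apply: coprime_TIg; apply: pnat_coprime aA (sub_pgroup _ bB').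
      by apply: sigma_disjoint => // /esym.
    rewrite Euclid_dvdM // in pW; case/orP: pW => [/(pgroupP aA)->//|pB'].
    have pb := pgroupP bB' p pr_p pB'.
    rewrite -(Lagrange_index sRL sCR) Euclid_dvdM // in pLC;
      case/orP: pLC => [pLR|pRC].
      exact: (pnatP _ (indexg_gt0 _ _) aLR).
    have pi := pnatP _ (indexg_gt0 _ _) iRC p pr_p pRC.
    by case: nebi; apply: sigma_inj pb pi.
  have hallZC : (sigma a).-Hall(L / C) (Z / C).
    by apply: quotient_pHall => //; apply: subset_trans nCG.
  have eqMZ := sub_pHall hallZC aM (quotientS _ sZM) (quotientS _ sML).
  have <- : M <*> C = Z <*> C.
    have nsC (D : {group gT}) : D \subset G -> C <| D <*> C.
      by move=> sDG; rewrite /normal joing_subr join_subG normG (subset_trans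
        sDG).
    apply: (@quotient_inj _ C (M <*> C)%G (Z <*> C)%G); rewrite ?inE ?nsC //.
    by rewrite !quotientYidr ?(subset_trans sZG).
  apply: normsY; last exact: subset_trans nCG.
  apply: normsI; last exact: subset_trans (normal_norm nsLG).
  exact: subset_trans (joing_subr _ _) (normG _).
have sBG := pHall_sub hallB; have [_ bB _] := and3P hallB.
pose E := <<class_support B G>>%G.
have nEG : G \subset 'N(E) by apply: norms_gen; apply: class_support_norm.
have sBE : B \subset E by apply: sub_gen; apply: sub_class_support.
have hallBJ g : g \in G -> (sigma b).-Hall(G) (B :^ g)%G by move=> gG;
  rewrite pHallJ.
have subE (D : {group gT}) : (forall g, g \in G -> B :^ g \subset D) ->
  E \subset D.
  by move=> sBD; rewrite gen_subG class_supportEr; apply/bigcupsP.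
have nZCE : E \subset 'N(Z <*> C) by apply: subE => g gG; apply: normZC;
  apply: hallBJ.
have sEG : E \subset G by apply: subE => g gG; rewrite -(conjGid gG) conjSg.
have min1 (D : {group gT}) : G \subset 'N(D) -> D \subset N -> D :!=: 1 ->
  D :=: N.
  by move=> nDG sDN ntD; apply: minN; rewrite ?ntD.
apply/idPn=> nBC.
have ntNB : [~: N, B] != 1.
  apply: contra nBC => /eqP cNB; rewrite subsetI sBG /=.
  by rewrite centsC; apply/commG1P.
have [tiNC|ntNC] := eqVneq (N :&: C) 1.
  have sNE : N \subset E.
    rewrite -(min1 (N :&: E)%G) ?subsetIl ?subsetIr ?normsI //=.
    apply: subG1_contra ntNB; rewrite subsetI commg_subl (subset_trans sBG) //=.
    by rewrite (subset_trans (commgS _ sBE)) // commg_subr (subset_trans sNG).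
  have sZCG : Z <*> C \subset G by rewrite join_subG sZG.
  (* As [N :&: C = 1], this intersection embeds in the quotient by [C]. Its image is a
     [sigma i]-group contained in the [sigma a]-group [Z / C]. *)
  have tiNZC : N :&: (Z <*> C) = 1.
    apply/eqP; rewrite trivg_card1 (card_isog (quotient_isog (H := C) _ _)) /=;
      first last.
    - by rewrite setIA [_ :&: N]setIC tiNC; apply/trivgP; rewrite subsetIl.
    - by rewrite subIset // (subset_trans sNG).
    have iQ : (sigma i).-group ((N :&: (Z <*> C)) / C).
      by apply: pgroupS (quotientS _ (subsetIl _ _)) (quotient_pgroup _ iN).
    rewrite (pnat_1 iQ) //.
    have sQ : (N :&: (Z <*> C)) / C \subset Z / C.
      by rewrite -(quotientYidr (subset_trans sZG nCG)) quotientS ?subsetIr.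
    apply: (pgroupS sQ); apply: sub_pgroup (quotient_pgroup _ aZ).
    by apply: sigma_disjoint => // /esym.
  case/negP: nZC; rewrite subsetI sZG centsC; apply/commG1P/trivgP.
  rewrite -tiNZC subsetI commg_subl (subset_trans sZG) //=.
  rewrite (subset_trans (commgS _ (joing_subl Z C))) // commg_subr.
  exact: subset_trans sNE nZCE.
have sNC : N \subset C.
  apply/setIidPl/(min1 (N :&: C)%G); rewrite ?subsetIl //=.
  exact: normsI nNG (normal_norm nsCG).
have abN : abelian N by apply: subset_trans sNC (subsetIr _ _).
set V := 'C_N(Z)%G.
(* Since [C] centralises [N], the subgroup [V] depends only on [Z <*> C]; therefore [E] normalises
   it. *)
have defV : 'C_N(Z <*> C) = V.
  by rewrite centY setIA; apply/setIidPl; rewrite subIset // centsC subsetIr.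
have nVE : E \subset 'N(V).
  rewrite -defV; apply: normsI; first exact: subset_trans nNG.
  exact: subset_trans nZCE (cent_norm _).
have nVN : N \subset 'N(V).
  by rewrite cents_norm // centsC (subset_trans (subsetIl _ _)).
have coNX c (X : {group gT}) : c <> i -> (sigma c).-group X ->
  coprime #|N| #|X|.
  move=> neci cX; apply: pnat_coprime iN (sub_pgroup _ cX).
  by apply: sigma_disjoint => // /esym.
(* Write [n = x * y] with [x] centralising [A], hence in [V], and [y] centralising [B :^ g]. Then
   [[~ n, b'] = [~ x, b'] ^ y], which stays in [V]. *)
have NBV g : g \in G -> [~: B :^ g, N] \subset V.
  move=> gG; have hallBg := hallBJ g gG; have [sBgG bBg _] := and3P hallBg.
  have sN : N \subset 'C_N(A) * 'C_N(B :^ g).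
    apply: coprime_permutable_cent_mul; rewrite ?(subset_trans sAG)
      ?(subset_trans sBgG) //.
    - exact: coNX aA.
    - exact: coNX bBg.
    - apply: pnat_coprime aA (sub_pgroup _ bBg).
      by apply: sigma_disjoint => // /esym.
    move=> n nN; have neab : a <> b by move=> eqab; case: neba.
    apply: permG neab hallA _; rewrite pHallJ //; exact: subsetP nN.
  rewrite commGC gen_subG; apply/subsetP=> _ /imset2P[n b' nN b'B ->].
  have /imset2P[x y /setIP[xN xA] /setIP[yN yB] ->] := subsetP sN n nN.
  have xV : x \in V by rewrite inE xN (subsetP (centS (subsetIl A L))).
  have -> : [~ x * y, b'] = [~ x, b'] ^ y.
    by rewrite commMgJ (_ : [~ y, b'] = 1) ?mulg1 //;
      apply/eqP/commgP/(centP yB).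
  rewrite memJ_norm ?(subsetP nVN) // commgEl groupM ?groupV // memJ_norm //.
  move: b' b'B; apply/subsetP; apply: subset_trans nVE.
  by apply: sub_gen; rewrite class_supportEr (bigcup_max g).
have sNEV : [~: N, E] \subset V.
  rewrite -quotient_cents2 // centsC.
  suff : E \subset 'C(N / V | 'Q) by rewrite sub_astabQ => /andP[].
  apply: subE => g gG; rewrite sub_astabQ quotient_cents2r ?NBV // andbT.
  apply: subset_trans nVE.
  by apply: sub_gen; rewrite class_supportEr (bigcup_max g).
have defN : [~: N, E] = N.
  apply: (min1 [~: N, E]%G); first by rewrite normsR.
    exact: subset_trans sNEV (subsetIl _ _).
  by apply: subG1_contra ntNB; apply: commgS.
case/negP: nZC; rewrite subsetI sZG centsC.
by rewrite -{1}defN (subset_trans sNEV) ?subsetIr.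
Qed.
End Automizers.

(** * Commuting subgroups generated by the elements of one class *)

Lemma chief_factor_quotient (gT : finGroupType) (G H K M : {group gT}) :
  M <| G -> M \subset K -> K \subset H ->
  chief_factor (G / M) (K / M) (H / M) -> H <| G -> chief_factor G K H.
Proof.
move=> nsMG sMK sKH /andP[/maxgroupP[/andP[pKH nKG] maxK] _] nsHG.
have sHG := normal_sub nsHG; have nMG := normal_norm nsMG.
have nsMH := normalS (subset_trans sMK sKH) sHG nsMG.
have nsMK := normalS sMK sKH nsMH.
have sKG := subset_trans sKH sHG; have nsMKG := normalS sMK sKG nsMG.
have nKGG : G \subset 'N(K).
  apply: normal_norm; rewrite -(quotientGK nsMG) -(quotientGK nsMKG)
    cosetpre_normal.
  by rewrite /normal quotientS.
rewrite /chief_factor nsHG andbT; apply/maxgroupP; split.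
  by rewrite nKGG andbT -(quotient_proper nsMK nsMH).
move=> L /andP[pLH nLG] sKL.
have nsML : M <| L := normalS (subset_trans sMK sKL) (proper_sub pLH) nsMH.
apply: (quotient_inj nsML nsMK); apply: (maxK (L / M)%G); last exact: quotientS.
by rewrite quotient_proper // pLH quotient_norms.
Qed.

(* The powers of the commutator are the commutators with the powers of z. *)
Lemma commg_coprime_elt (gT : finGroupType) (pi : nat_pred) (x z : gT) :
  commute z [~ x, z] -> pi.-elt [~ x, z] -> pi^'.-elt z -> [~ x, z] = 1.
Proof.
move=> czk pik piz; apply/eqP; rewrite -order_eq1.
have : #[[~ x, z]] %| #[z].
  by rewrite order_dvdn -commgX // expg_order commg1.
by move/(pnat_dvd)/(_ piz) => pi'k; rewrite (pnat_1 pik pi'k).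
Qed.

(** For a group [G] this is the smallest normal subgroup whose index is prime to [pi]. *)
Definition elt_gen (gT : finGroupType) (pi : nat_pred) (G : {set gT}) :=
  <<[set x in G | pi.-elt x]>>.

Canonical elt_gen_group (gT : finGroupType) pi (G : {set gT}) :=
  Eval hnf in [group of elt_gen pi G].

Lemma elt_gen_normal (gT : finGroupType) pi (G : {group gT}) :
  elt_gen pi G <| G.
Proof.
rewrite /normal gen_subG; apply/andP; split.
  by apply/subsetP=> x; rewrite inE => /andP[].
apply: norms_gen; apply/subsetP=> g gG; rewrite inE.
by apply/subsetP=> _ /imsetP[x + ->]; rewrite !inE p_eltJ groupJr.
Qed.

Lemma mem_elt_gen (gT : finGroupType) (pi : nat_pred) (G : {set gT}) x :
  x \in G -> pi.-elt x -> x \in elt_gen pi G.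
Proof. by move=> xG pix; rewrite mem_gen // inE xG. Qed.

Section Bounded.

Variables (I : Type) (sigma : I -> nat_pred).
Hypothesis sigma_part : prime_partition sigma.

(* Clause (ii) read on elements: those whose order is prime to both classes act
   trivially on the chief factor. *)
Definition bounded_automizers (gT : finGroupType) (G : {group gT}) : Prop :=
  forall H K : {group gT}, chief_factor G K H ->
  forall i, (sigma i).-group (H / K) ->
  exists2 j, j <> i & forall x, x \in G ->
    [predU sigma i & sigma j]^'.-elt x -> x \in 'C(H / K | 'Q).

Lemma quotient_bounded_automizers (gT : finGroupType) (G M : {group gT}) :
  M <| G -> bounded_automizers G -> bounded_automizers (G / M).
Proof.
move=> nsMG bG Hb Kb chb i iHK.
have /andP[/maxgroupp/andP[pKH nKG] nsHG] := chb.
have [H defH sMH sHG] := inv_quotientS nsMG (normal_sub nsHG).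
have nsMH := normalS sMH sHG nsMG.
have sKbH : Kb \subset H / M by rewrite -defH proper_sub.
have [K defK sMK sKH] := inv_quotientS nsMH sKbH.
have nsHG' : H <| G.
  by rewrite -(quotientGK nsMG) -(quotientGK nsMH) cosetpre_normal -defH.
have chK : chief_factor G K H.
  by apply: (chief_factor_quotient nsMG sMK sKH) => //; rewrite -defK -defH.
have /andP[/maxgroupp/andP[_ nKG'] _] := chK.
have nMG := normal_norm nsMG.
have nKH := subset_trans sHG nKG'.
have iHK' : (sigma i).-group (H / K).
  move: iHK; rewrite /pgroup !card_quotient //; last first.
    by rewrite (subset_trans (normal_sub nsHG)).
  by rewrite defH defK index_quotient_eq ?(subset_trans sHG) // subIset //
    sMK orbT.
have [j neji hj] := @bG H K chK i iHK'; exists j => //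
  _ /morphimP[x nMx xG ->] jx.
set pi : nat_pred := [predU sigma i & sigma j]^' in jx *.
(* The representative [x] need not be a [pi]-element, but its [pi]-part has the same image modulo
   [M]. *)
rewrite -(constt_p_elt jx) -morph_constt //.
have := hj x.`_pi (groupX _ xG) (p_elt_constt _ _).
rewrite !astabQR ?(subset_trans (normal_sub nsHG)) // !inE => /andP[_ sxK].
have nMxp : x.`_pi \in 'N(M) by rewrite groupX.
have := subsetP nKG _ (mem_quotient M (groupX _ xG : x.`_pi \in G)).
rewrite inE => -> /=; rewrite defH defK -quotient_set1 //.
by rewrite -quotientR ?sub1set ?quotientS // (subset_trans sHG).
Qed.

(** * Groups without nontrivial normal subgroups of order prime to [sigma i] *)

Section PcoreCore.

Variables (gT : finGroupType) (G : {group gT}) (i : I).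
Hypothesis sepG : sigma_separable sigma G.
Hypothesis bG : bounded_automizers G.
Hypothesis O1 : 'O_(sigma i)^'(G) = 1.

Let F := 'O_(sigma i)(G).
Let D j := elt_gen (sigma j) G.

Let nF (M : {group gT}) : M \subset F -> (sigma i).-group M.
Proof. by move=> sMF; apply: pgroupS sMF (pcore_pgroup _ _). Qed.

(** Coprime action: an element trivial on all chief factors below [F] centralises [F]. It then lies
    in [F], by [cent_sub_pcore], and has order prime to that of [F]. *)
Lemma cent_pcore_chief_eq1 z : z \in G -> (sigma i)^'.-elt z ->
  (forall M K : {group gT}, chief_factor G K M -> M \subset F ->
    z \in 'C(M / K | 'Q)) ->
  z = 1.
Proof.
move=> zG i'z cz.
have cM (M : {group gT}) : M <| G -> M \subset F -> z \in 'C(M).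
  have [n] := ubnP #|M|; elim: n M => // n IHn M; rewrite ltnS => leMn nsMG sMF.
  have [->|ntM] := eqVneq (M : {set gT}) 1; first by rewrite cent1T inE.
  have [K chK] := chief_factor_exists nsMG ntM.
  have /andP[/maxgroupp/andP[pKM nKG] _] := chK; have sKM := proper_sub pKM.
  have nsKG : K <| G by rewrite /normal nKG (subset_trans sKM) ?normal_sub.
  have czK : z \in 'C(K).
    by apply: IHn (subset_trans sKM sMF) => //;
      apply: leq_trans (proper_card pKM) leMn.
  have := cz M K chK sMF; rewrite astabQR ?(subset_trans (normal_sub nsMG)) //
    !inE => /andP[_ szM].
  apply/centP=> m mM; apply/esym/commgP.
  have mzK : [~ m, z] \in K.
    by rewrite -groupV invg_comm (subsetP szM) // mem_commg ?set11.
  apply/eqP/(@commg_coprime_elt _ (sigma i)) => //; first exact: (centP czK).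
  exact: mem_p_elt (nF (subset_trans sKM sMF)) mzK.
have zF : z \in F.
  apply: (subsetP (cent_sub_pcore sigma_part sepG O1)).
  by rewrite inE zG cM ?pcore_normal.
apply/eqP; rewrite -order_eq1; apply/eqP.
exact: pnat_1 (mem_p_elt (pcore_pgroup _ _) zF) i'z.
Qed.

Lemma elt_gen_cent_chief (M K : {group gT}) : chief_factor G K M ->
  M \subset F ->
  exists2 a, a <> i & (forall x, x \in G ->
    [predU sigma i & sigma a]^'.-elt x -> x \in 'C(M / K | 'Q)) /\
   (forall k, k <> i -> k <> a -> D k \subset 'C(M / K | 'Q)).
Proof.
move=> chK sMF.
have [a neai ha] := @bG M K chK i (quotient_pgroup _ (nF sMF)).
exists a => //; split=> // k neki neka.
rewrite gen_subG; apply/subsetP=> x; rewrite inE => /andP[xG kx].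
apply: ha => //; apply: sub_in_pnat kx => p _ pk; rewrite !inE /= negb_or.
by apply/andP; split; apply/negP=> p'; [case: neki | case: neka];
  apply: (sigma_inj sigma_part) pk p'.
Qed.

(** On each chief factor below [F] at most one class besides [i] acts nontrivially, so [D j] or
    [D k] acts trivially, and with it the commutator, which lies in both. Its elements of prime
    order outside [sigma i] are therefore trivial. *)
Lemma commg_elt_gen_sub_pcore j k : j <> i -> k <> i -> j <> k ->
  [~: D j, D k] \subset F.
Proof.
move=> neji neki nejk.
have nsD l : D l <| G := elt_gen_normal _ _.
have nDD l m : D l \subset 'N(D m).
  by apply: subset_trans (normal_sub (nsD l)) (normal_norm (nsD m)).
have sRj : [~: D j, D k] \subset D j by rewrite commg_subl nDD.
have sRk : [~: D j, D k] \subset D k by rewrite commg_subr nDD.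
apply: pcore_max; last first.
  apply/andP; split; first exact: subset_trans sRj (normal_sub (nsD j)).
  by apply: normsR; apply: normal_norm.
apply/pgroupP=> p pr_p pR; have [x xR ox] := Cauchy pr_p pR.
apply/idPn=> npi; suff x1 : x = 1 by rewrite -ox x1 order1 in pr_p.
apply: cent_pcore_chief_eq1.
- exact: subsetP (normal_sub (nsD j)) _ (subsetP sRj x xR).
- by rewrite /p_elt ox pnatE.
move=> M K chK sMF; have [a neai [_ ha]] := elt_gen_cent_chief chK sMF.
have [eqja|neja] := sigma_eq_dec sigma_part j a.
  by apply: (subsetP (ha k neki _)) (subsetP sRk x xR); rewrite -eqja => /esym.
exact: (subsetP (ha j neji neja)) (subsetP sRj x xR).
Qed.

(** For [x] in [D j] and a [sigma k]-element [y], the image of [[~ x, y]] in [M / K] is a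
    [sigma i]-element centralised by [y], so it is trivial by coprimality. *)
Lemma commg_elt_gen_sub j k (M K : {group gT}) :
  j <> i -> k <> i -> M <| G -> K <| G -> M \subset F ->
  [~: D j, D k] \subset M -> D k \subset 'C(M / K | 'Q) ->
  [~: D j, D k] \subset K.
Proof.
move=> neji neki nsMG nsKG sMF sRM cMD.
have nKG := normal_norm nsKG.
have sDG l : D l \subset G := normal_sub (elt_gen_normal _ _).
have nKD l : D l \subset 'N(K) := subset_trans (sDG l) nKG.
rewrite -quotient_cents2 // centsC.
suff : D k \subset 'C(D j / K | 'Q) by rewrite sub_astabQ => /andP[].
rewrite gen_subG; apply/subsetP=> y; rewrite inE => /andP[yG ky].
have yD : y \in D k by apply: mem_elt_gen.
rewrite -sub1set sub_astabQ sub1set (subsetP (nKD k)) //=.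
apply/subsetP=> _ /morphimP[_ _ /set1P-> ->];
  apply/centP=> _ /morphimP[x nKx xD ->].
have nKy := subsetP (nKD k) y yD.
apply/esym/commgP/eqP; apply: (@commg_coprime_elt _ (sigma i)).
- rewrite -morphR //; apply: (centP _ _ (mem_quotient K _)).
  + have := cMD; rewrite sub_astabQ => /andP[_ /subsetP]; apply;
    exact: mem_quotient.
  + by rewrite (subsetP sRM) ?mem_commg.
- rewrite -morphR //; apply: (@mem_p_elt _ _ _ (M / K)).
    exact: quotient_pgroup (nF sMF).
  by rewrite mem_quotient ?(subsetP sRM) ?mem_commg.
apply: morph_p_elt => //; apply: sub_in_pnat ky => p _;
  apply: sigma_disjoint => //.
by move/esym.
Qed.

(** If the commutator [M] were nontrivial, [D j] or [D k] would centralise a chief factor [M / K],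
    and the previous lemma would push [M] into [K]. *)
Lemma commg_elt_gen_eq1 j k : j <> i -> k <> i -> j <> k -> [~: D j, D k] = 1.
Proof.
move=> neji neki nejk; set M := [~: D j, D k]%G.
have sMF : M \subset F := commg_elt_gen_sub_pcore neji neki nejk.
have nsD l : D l <| G := elt_gen_normal _ _.
have nsMG : M <| G.
  apply/andP; split; first exact: subset_trans sMF (pcore_sub _ _).
  by apply: normsR; apply: normal_norm.
apply/eqP/idPn=> ntM; have [K chK] := chief_factor_exists nsMG ntM.
have /andP[/maxgroupp/andP[pKM nKG] _] := chK.
have nsKG : K <| G by rewrite /normal nKG (subset_trans (proper_sub pKM))
  ?normal_sub.
have [a neai [_ ha]] := elt_gen_cent_chief chK sMF.
case/andP: pKM => _ /negP[].
have [eqka|neka] := sigma_eq_dec sigma_part k a; last first.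
  exact: (@commg_elt_gen_sub j k M K) (ha k neki neka).
rewrite /= commGC; apply: (@commg_elt_gen_sub k j M K) => //;
  first by rewrite commGC.
by apply: ha => //; rewrite -eqka.
Qed.

(** Take an element of [D j] of prime order outside both classes, and a chief factor below [F] with
    exceptional class [a]. If [a = j] the order of the element makes it act trivially; if not, all
    of [D j] acts trivially. *)
Lemma elt_gen_biprimary j : j <> i -> [predU sigma i & sigma j].-group (D j).
Proof.
move=> neji; have sDG : D j \subset G := normal_sub (elt_gen_normal _ _).
apply/pgroupP=> p pr_p pD; have [x xD ox] := Cauchy pr_p pD.
apply/idPn=> npij; suff x1 : x = 1 by rewrite -ox x1 order1 in pr_p.
apply: cent_pcore_chief_eq1; first exact: subsetP sDG x xD.
  by rewrite /p_elt ox pnatE // inE /=; apply: contra npij => pi;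
    rewrite inE /= pi.
move=> M K chK sMF; have [a neai [hx ha]] := elt_gen_cent_chief chK sMF.
have [eqja|neja] := sigma_eq_dec sigma_part j a.
  by apply: hx; rewrite ?(subsetP sDG) // -eqja /p_elt ox pnatE.
exact: (subsetP (ha j neji neja)).
Qed.

End PcoreCore.
End Bounded.

(** * Quotients of residually biprimary groups *)

Section Covered.

Variables (I : Type) (sigma : I -> nat_pred).
Hypothesis sigma_part : prime_partition sigma.

Lemma sub_biprimaryS (gT : finGroupType) (G H : {group gT}) :
  H \subset G -> sub_biprimary sigma G -> sub_biprimary sigma H.
Proof.
move=> sHG [sepG [i [j [neij ijG]]]]; split; first exact: sigma_separableS sepG.
by exists i, j; split=> //; apply: pgroupS ijG.
Qed.

Lemma residually_biprimary_comp (gT : finGroupType) (G : {group gT}) :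
  (forall x, x \in G -> x != 1 ->
    exists (rT : finGroupType) (f : {morphism G >-> rT}) (P : {group rT}),
      [/\ f x != 1, f @* G \subset P & residually_biprimary sigma P]) ->
  residually_biprimary sigma G.
Proof.
move=> resG x xG ntx; have [rT [f [P [ntfx sfGP resP]]]] := resG x xG ntx.
have fxP : f x \in P by rewrite (subsetP sfGP) ?mem_morphim.
have [hT [g [ntgfx bigP]]] := resP _ fxP ntfx.
have sG : G \subset f @*^-1 P by rewrite -sub_morphim_pre.
exists hT, (restrm_morphism sG (comp_morphism f g)); split=> //.
apply: sub_biprimaryS bigP => /=.
by rewrite morphim_restrm setIid morphim_comp morphimS.
Qed.

Lemma sub_biprimary_residually (gT : finGroupType) (G : {group gT}) :
  sub_biprimary sigma G -> residually_biprimary sigma G.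
Proof.
move=> bG x xG ntx; exists gT, (idm_morphism G); split=> //.
by apply: sub_biprimaryS bG; apply/subsetP=> _ /morphimP[y _ yG ->].
Qed.

(* Clause (iii), with the embedding into a direct product replaced by separation
   of points. *)
Definition covered (gT : finGroupType) (G : {group gT}) : Prop :=
  exists (hT : finGroupType) (E : {group hT}) (f : {morphism E >-> gT}),
    f @* E = G /\ residually_biprimary sigma E.

Lemma sub_biprimary_covered (gT : finGroupType) (G : {group gT}) :
  sub_biprimary sigma G -> covered G.
Proof.
move=> bG; exists gT, G, (idm_morphism G); split; first exact: morphim_idm.
exact: sub_biprimary_residually.
Qed.

(** Common to the two fibre products below. The third coordinate is examined only on triples that
    the first two projections kill. *)
Lemma residually_biprimary_prod3 (gT1 gT2 gT3 : finGroupType)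
    (E1 : {group gT1}) (E2 : {group gT2})
    (E : {group (gT1 * gT2 * gT3)%type}) :
  residually_biprimary sigma E1 -> residually_biprimary sigma E2 ->
  (forall t, t \in E -> t.1.1 \in E1 /\ t.1.2 \in E2) ->
  (forall t, t \in E -> t.1 = 1 -> t.2 != 1 ->
    exists2 E3 : {group gT3}, (forall t', t' \in E -> t'.2 \in E3) &
      residually_biprimary sigma E3) ->
  residually_biprimary sigma E.
Proof.
move=> res1 res2 proj12 proj3; apply: residually_biprimary_comp => t tE ntt.
have sT (hT : finGroupType) (A : {group hT}) : A \subset [set: hT] := subsetT A.
pose f3 := restrm_morphism (sT _ E) (snd_morphism (gT1 * gT2)%type gT3).
pose f0 := restrm_morphism (sT _ E) (fst_morphism (gT1 * gT2)%type gT3).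
have sf0 : E \subset f0 @*^-1 [set: _] by rewrite -sub_morphim_pre ?subsetT.
pose f1 := restrm_morphism sf0 (comp_morphism f0 (fst_morphism gT1 gT2)).
pose f2 := restrm_morphism sf0 (comp_morphism f0 (snd_morphism gT1 gT2)).
have [nt1|/negPn/eqP t1] := boolP (t.1.1 != 1).
  exists gT1, f1, E1; split=> //; apply/subsetP=> _ /morphimP[t' _ t'E ->].
  by have [] := proj12 t' t'E.
have [nt2|/negPn/eqP t2] := boolP (t.1.2 != 1).
  exists gT2, f2, E2; split=> //; apply/subsetP=> _ /morphimP[t' _ t'E ->].
  by have [] := proj12 t' t'E.
have t11 : t.1 = 1 by rewrite [t.1]surjective_pairing t1 t2.
have nt3 : t.2 != 1.
  by apply: contraNneq ntt => t3; rewrite [t]surjective_pairing t11 t3.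
have [E3 pE3 res3] := proj3 t tE t11 nt3.
exists gT3, f3, E3; split=> //; apply/subsetP=> _ /morphimP[t' _ t'E ->].
exact: pE3.
Qed.

(** The cover is the fibre product of [E1], [E2] and [G] over the two quotients. A triple
    [(1, 1, g)] in it has [g] in [N1 :&: N2 = 1]. *)
Lemma covered_subdirect (gT : finGroupType) (G N1 N2 : {group gT}) :
  N1 <| G -> N2 <| G -> N1 :&: N2 = 1 ->
  covered (G / N1) -> covered (G / N2) -> covered G.
Proof.
move=> nsN1 nsN2 tiN [h1 [E1 [f1 [fE1 res1]]]] [h2 [E2 [f2 [fE2 res2]]]].
have [nN1 nN2] := (subsetP (normal_norm nsN1), subsetP (normal_norm nsN2)).
pose E := [set t : h1 * h2 * gT | [&& t.1.1 \in E1, t.1.2 \in E2, t.2 \in G,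
  f1 t.1.1 == coset N1 t.2 & f2 t.1.2 == coset N2 t.2]].
have gE : group_set E.
  apply/group_setP; split=> [|t u]; first by rewrite inE !group1 !morph1 !eqxx.
  rewrite !inE => /and5P[t1 t2 t3 /eqP e1 /eqP e2] /and5P[u1 u2 u3 /eqP e1' /eqP
    e2'].
  by rewrite !groupM // !morphM ?nN1 ?nN2 // e1 e2 e1' e2' !eqxx.
pose EG := Group gE.
exists _, EG, (restrm_morphism (subsetT EG) (snd_morphism _ _)); split.
  rewrite morphim_restrm setIid; apply/setP=> g;
    apply/morphimP/idP=> [[t _]|gG].
    by rewrite inE => /and5P[_ _ tG _ _] ->.
  have: coset N1 g \in f1 @* E1 by rewrite fE1 mem_quotient.
  case/morphimP=> e1 _ E1e eq1.
  have: coset N2 g \in f2 @* E2 by rewrite fE2 mem_quotient.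
  case/morphimP=> e2 _ E2e eq2.
  by exists (e1, e2, g); rewrite ?inE //= E1e E2e gG eq1 eq2 !eqxx.
apply: (@residually_biprimary_prod3 _ _ _ E1 E2) => // t; rewrite inE.
  by case/and5P.
case/and5P=> _ _ gG /eqP c1 /eqP c2 t1 /eqP[].
apply/set1P; rewrite -[[set 1]]tiN inE.
by apply/andP; split; apply: coset_idr;
  rewrite ?nN1 ?nN2 // -?c1 -?c2 t1 morph1.
Qed.

(* The triples (e1, e2, y) lying over (ay, by, y) form a group, which covers ABY
   through (ay) y^-1 (by) = aby. *)
Lemma covered_central_mul (gT : finGroupType) (A B Y : {group gT}) :
  Y \subset 'N(A) -> Y \subset 'N(B) -> [~: A, B] = 1 ->
    sub_biprimary sigma Y ->
  covered (A <*> Y) -> covered (B <*> Y) -> covered (A <*> B <*> Y).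
Proof.
move=> nAY nBY cAB bY [h1 [E1 [f1 [fE1 res1]]]] [h2 [E2 [f2 [fE2 res2]]]].
pose E := [set t : h1 * h2 * gT | [&& t.1.1 \in E1, t.1.2 \in E2, t.2 \in Y,
  f1 t.1.1 * t.2^-1 \in A & f2 t.1.2 * t.2^-1 \in B]].
have gE : group_set E.
  apply/group_setP; split=> [|t u]; first
    by rewrite inE !group1 /= !morph1 invg1 mulg1 !group1.
  rewrite !inE => /and5P[t1 t2 t3 e1 e2] /and5P[u1 u2 u3 e1' e2'].
  have eqJ (x x' y y' : gT) : x * x' * (y * y')^-1 = x * y^-1 * (x' * y'^-1) ^
    y^-1.
    by rewrite conjgE invgK invMg !mulgA mulgKV.
  apply/and5P; split; try exact: groupM.
    by rewrite /= morphM // eqJ groupM // memJ_norm // groupV (subsetP nAY).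
  by rewrite /= morphM // eqJ groupM // memJ_norm // groupV (subsetP nBY).
pose EG := Group gE.
pose phi (t : h1 * h2 * gT) := f1 t.1.1 * t.2^-1 * f2 t.1.2.
have phiM : {in EG &, {morph phi : t u / t * u}}.
  move=> t u; rewrite !inE => /and5P[t1 t2 t3 e1 e2] /and5P[u1 u2 u3 e1' e2'].
  rewrite /phi /= !morphM //= invMg.
  (* Multiplicativity of [phi] amounts to exchanging an element of [A] with an element of [B]. *)
  have cab : commute ((f1 u.1.1 * u.2^-1) ^ t.2^-1) (f2 t.1.2 * t.2^-1).
    apply/commgP; rewrite -in_set1 -[[set 1]]cAB mem_commg //.
    by rewrite memJ_norm // groupV (subsetP nAY).
  have := cab; rewrite /commute conjgE invgK => cab'.
  have -> : f1 t.1.1 * f1 u.1.1 * (u.2^-1 * t.2^-1) * (f2 t.1.2 * f2 u.1.2) =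
    f1 t.1.1 * t.2^-1 * ((t.2 * (f1 u.1.1 * u.2^-1 * t.2^-1)) * (f2 t.1.2 *
      t.2^-1)) * t.2 * f2 u.1.2.
    by rewrite !mulgA !mulgKV.
  by rewrite cab' !mulgA !mulgKV.
exists _, EG, (Morphism phiM); split.
  have nABY : Y \subset 'N(A <*> B) by rewrite normsY.
  apply/setP=> g; apply/morphimP/idP=> [[t _]|].
    rewrite inE => /and5P[t1 t2 t3 e1 e2] -> /=; rewrite /phi.
    have AP z : z \in A -> z \in A <*> B <*> Y by apply/subsetP;
      rewrite -joingA joing_subl.
    apply: groupM; first exact: AP.
    rewrite -[f2 _](mulgKV t.2); apply: groupM;
      last exact: subsetP (joing_subr _ _) _ t3.
    apply: (subsetP (joing_subl _ Y)); exact: subsetP (joing_subr A B) _ e2.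
  have nAB : B \subset 'N(A) by rewrite cents_norm // centsC; apply/commG1P.
  rewrite /= (norm_joinEr nABY) /= (norm_joinEr nAB).
  case/mulsgP=> _ y /mulsgP[a b aA bB ->] yY ->.
  have: a * y \in f1 @* E1 by rewrite fE1 /= norm_joinEr // mem_mulg.
  case/morphimP=> e1 _ E1e eq1.
  have: b * y \in f2 @* E2 by rewrite fE2 /= norm_joinEr // mem_mulg.
  case/morphimP=> e2 _ E2e eq2.
  exists (e1, e2, y); rewrite ?inE //=; last
    by rewrite /phi /= -eq1 -eq2 mulgK mulgA.
    by rewrite E1e E2e yY -eq1 -eq2 !mulgK aA bB.
  by rewrite E1e E2e yY -eq1 -eq2 !mulgK aA bB.
apply: (@residually_biprimary_prod3 _ _ _ E1 E2) => // t; rewrite inE.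
  by case/and5P.
case/and5P=> _ _ _ _ _ _ _; exists Y.
  by move=> t'; rewrite inE => /and5P[].
exact: sub_biprimary_residually.
Qed.

Lemma bounded_covered_pcore1 (gT : finGroupType) (G : {group gT}) i :
  (exists j, j <> i) -> sigma_separable sigma G -> bounded_automizers sigma G ->
  'O_(sigma i)^'(G) = 1 -> covered G.
Proof.
move=> [j0 nej0] sepG bG O1.
have [Y hallY] := sigma_Hall_exists sigma_part i sepG.
have [sYG iY i'Y] := and3P hallY.
pose D j := elt_gen (sigma j) G.
have nsD j : D j <| G := elt_gen_normal _ _.
have nYN (M : {group gT}) : M <| G -> Y \subset 'N(M).
  by move/normal_norm; apply: subset_trans.
have bY : sub_biprimary sigma Y.
  split; first exact: sigma_separableS sepG.
  by exists i, j0; split; [move/esym | apply: sub_in_pnat iY => p _ pi;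
    rewrite inE /= pi].
(* Primes again stand in for classes: [W] is the join of the [D j] for the classes other than [i]
   met so far, and the last clause, on classes not yet met, lets the next [D j] be adjoined by
   [covered_central_mul]. *)
have [W [nsWG covWY gW _]] : exists W : {group gT}, [/\ W <| G,
  covered (W <*> Y),
    forall q j, q \in primes #|G| -> q \in sigma j -> j <> i -> D j \subset W &
    forall k, k <> i -> (forall q, q \in primes #|G| -> q \notin sigma k) ->
      [~: W, D k] = 1].
  elim: (primes #|G|) => [|q qs [W [nsWG covWY gW cW]]].
    exists 1%G; split=> // [||k _ _]; first exact: normal1.
      by apply/sub_biprimary_covered/(sub_biprimaryS _ bY); rewrite /= joing1G.
    exact: comm1G.
  have [old|[j [qj neji newj]]] : (forall k, q \in sigma k -> k <> i ->
    D k \subset W) \/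
      (exists j, [/\ q \in sigma j, j <> i & forall q', q' \in qs ->
        q' \notin sigma j]).
    have [pr_q|npr_q] := boolP (prime q); last first.
      by left=> k qk; rewrite (sigma_prime sigma_part qk) in npr_q.
    have [j qj] := sigma_cover sigma_part pr_q.
    have [eqji|neji] := sigma_eq_dec sigma_part j i.
      by left=> k qk; rewrite (sigma_inj sigma_part qk qj).
    have [/hasP[q' q'qs q'j]|/hasPn newj] := boolP (has (mem (sigma j)) qs).
      by left=> k qk neki; rewrite (sigma_inj sigma_part qk qj);
        apply: gW q'j neji.
    by right; exists j.
  - exists W; split=> // [q' k|k neki newk].
      by rewrite inE => /predU1P[->|]; [apply: old | apply: gW].
    by apply: cW => // q' q'qs; apply: newk; rewrite inE q'qs orbT.
  have cWD : [~: W, D j] = 1 by apply: cW.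
  exists (W <*> D j)%G; split.
  - by rewrite /= normalY.
  - apply: covered_central_mul => //; [exact: nYN | exact: nYN (nsD j) | ].
    apply: sub_biprimary_covered; split.
      apply: sigma_separableS sepG.
      by rewrite join_subG sYG (normal_sub (nsD j)).
    exists i, j; split; first by move=> eqij; case: neji.
    rewrite /= (norm_joinEr (nYN _ (nsD j))) pgroupM.
    rewrite (elt_gen_biprimary sigma_part sepG bG O1 neji) /=.
    by apply: sub_in_pnat iY => p _ pi; rewrite inE /= pi.
  - move=> q' k; rewrite inE => /predU1P[->|q'qs] q'k neki.
      by rewrite (sigma_inj sigma_part q'k qj) joing_subr.
    exact: subset_trans (gW q' k q'qs q'k neki) (joing_subl _ _).
  move=> k neki newk; apply/commG1P; rewrite join_subG.
  have -> /= : W \subset 'C(D k).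
    by apply/commG1P/cW => // q' q'qs; apply: newk; rewrite inE q'qs orbT.
  apply/commG1P/(commg_elt_gen_eq1 sigma_part sepG bG O1 neji neki) => eqjk.
  by have := newk q; rewrite inE eqxx -eqjk qj => /(_ isT).
suff <- : (W <*> Y)%G = G by [].
apply/group_inj/eqP; rewrite eqEsubset /= join_subG normal_sub //= sYG /=.
have sWYG : W <*> Y \subset G by rewrite join_subG normal_sub.
(* A prime dividing the index of [W <*> Y] is not in [sigma i], as [Y] is a Hall subgroup; but for
   any other class [j] its Sylow subgroups lie in [D j], hence in [W]. *)
apply/idPn; rewrite -indexg_eq1 => neq1.
have idx1 : (1 < #|G : W <*> Y|)%N by rewrite ltn_neqAle eq_sym neq1 indexg_gt0.
have pr_p := pdiv_prime idx1; set p := pdiv _ in pr_p.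
have p_idx : p %| #|G : W <*> Y| := pdiv_dvd _.
have pG : p \in primes #|G|.
  by rewrite mem_primes pr_p cardG_gt0 (dvdn_trans p_idx) ?dvdn_indexg.
have [j pj] := sigma_cover sigma_part pr_p.
have [eqji|neji] := sigma_eq_dec sigma_part j i.
  have := i'Y; rewrite -(Lagrange_index sWYG (joing_subr _ _)) pnatM =>
    /andP[i'i _].
  by have := pnatP _ (indexg_gt0 _ _) i'i p pr_p p_idx; rewrite inE /= -eqji pj.
have [P sylP] := Sylow_exists p G; have [sPG pP p'P] := and3P sylP.
have sPW : P \subset W <*> Y.
  apply: subset_trans (joing_subl _ _); apply: subset_trans (gW p j pG pj neji).
  apply/subsetP=> x xP; apply: mem_elt_gen; first exact: subsetP xP.
  by apply: sub_in_pnat (mem_p_elt pP xP) => q _ /eqP->.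
move: p'P; rewrite -(Lagrange_index sWYG sPW) pnatM => /andP[p'i _].
by have := pnatP _ (indexg_gt0 _ _) p'i p pr_p p_idx; rewrite !inE eqxx.
Qed.

(** The class [i] is chosen with nontrivial core. If the complementary core is nontrivial too, the
    two intersect trivially, and [G] is a subdirect product of two smaller quotients. *)
Lemma bounded_covered (gT : finGroupType) (G : {group gT}) :
  (exists i j : I, i <> j) -> sigma_separable sigma G ->
  bounded_automizers sigma G -> covered G.
Proof.
move=> [i0 [j0 neij0]].
have [n] := ubnP #|G|; elim: n gT G => // n IHn gT G.
rewrite ltnS => leGn sepG bG.
have [G1|ntG] := eqVneq (G : {set gT}) 1.
  apply: sub_biprimary_covered; split=> //; exists i0, j0; split=> //.
  by rewrite G1 pgroup1.
have [i ntN] := sigma_pcore_neq1 sepG ntG.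
have covQ (M : {group gT}) : M <| G -> M :!=: 1 -> covered (G / M).
  move=> nsMG ntM; apply: IHn.
  - exact: leq_trans (ltn_quotient ntM (normal_sub nsMG)) leGn.
  - exact: quotient_sigma_separable (normal_norm nsMG) sepG.
  exact: quotient_bounded_automizers.
have [O1|ntM] := eqVneq 'O_(sigma i)^'(G) 1.
  apply: bounded_covered_pcore1 O1 => //.
  have [eqi|nei] := sigma_eq_dec sigma_part i0 i; last by exists i0.
  by exists j0; rewrite -eqi => /esym.
have tiO : 'O_(sigma i)(G) :&: 'O_(sigma i)^'(G) = 1.
  exact: coprime_TIg (pnat_coprime (pcore_pgroup _ _) (pcore_pgroup _ _)).
by apply: (covered_subdirect _ _ tiO); rewrite ?pcore_normal //;
  apply: covQ; rewrite ?pcore_normal.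
Qed.

End Covered.

(** * The equivalences *)

Section Equivalences.

Variables (I : Type) (sigma : I -> nat_pred).
Hypothesis sigma_part : prime_partition sigma.

Lemma chief_automizer_norm (gT : finGroupType) (G H K : {group gT}) :
  chief_factor G K H -> G \subset 'N('C_G(H / K | 'Q)).
Proof.
move=> chK; have /andP[/maxgroupp/andP[_ nKG] nsHG] := chK.
apply: normsI; first exact: normG.
rewrite astabQ; apply: subset_trans (morphpre_norm _ _).
rewrite -sub_morphim_pre //.
by apply: subset_trans (cent_norm _); rewrite quotient_norms ?normal_norm.
Qed.

Lemma Hall_permutable_bounded (gT : finGroupType) (G : {group gT}) :
  (exists i j : I, i <> j) -> sigma_separable sigma G ->
  Hall_permutable sigma G -> chief_automizers_sigma_bounded sigma G.
Proof.
move=> [i0 [j0 neij0]] sepG permG H K chK i iHK.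
have /andP[/maxgroupp/andP[pKH nKG] nsHG] := chK.
have sKG : K \subset G := subset_trans (proper_sub pKH) (normal_sub nsHG).
have [|j [neji jC]] := minnormal_automizer sigma_part _
  (quotient_sigma_separable nKG sepG) (morphim_Hall_permutable sigma_part nKG
    sepG permG)
  (chief_factor_minnormal chK) (quotientS _ (normal_sub nsHG))
  (sigma_of_eq_pgroup sigma_part iHK).
  have [eqi|nei] := sigma_eq_dec sigma_part i0 i; last by exists i0.
  by exists j0; rewrite -eqi => /esym.
exists j; split=> //; right.
have nCG := chief_automizer_norm chK.
(* The automizer contains [K], and its image in [G / K] is the centraliser of [H / K] there, so the
   two indices agree. *)
rewrite /pgroup card_quotient // -(index_quotient_eq (H := K)) //=.
- rewrite astabQ /quotient morphim_setIpre //.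
- apply: subset_trans (subsetIr _ _) _; rewrite subsetI sKG astabQ /=.
  by rewrite -{1}(ker_coset K) morphpreS ?sub1G.
- exact: subsetIl.
Qed.

Lemma chief_bounded_automizers (gT : finGroupType) (G : {group gT}) :
  chief_automizers_sigma_bounded sigma G -> bounded_automizers sigma G.
Proof.
move=> bG H K chK i iHK; have nCG := chief_automizer_norm chK.
have /mingroupP[/andP[ntHK _] _] := chief_factor_minnormal chK.
have iHK' : forall k, sigma_of sigma #|H / K| k <-> k = i.
  by apply: sigma_of_pgroup; rewrite ?cardG_gt1.
have [j [neji jC]] := bG H K chK i iHK'.
exists j => // x xG jx; set pi : nat_pred := [predU sigma i & sigma j].
have piC : pi.-group (G / 'C_G(H / K | 'Q)).
  by case: jC => // jC; apply: sub_pgroup jC => p pj; rewrite inE /= pj orbT.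
have nCx := subsetP nCG x xG.
have: coset 'C_G(H / K | 'Q) x = 1.
  apply/eqP; rewrite -order_eq1; apply/eqP.
  apply: (@pnat_1 pi); first exact: mem_p_elt piC (mem_quotient _ xG).
  exact: morph_p_elt nCx jx.
by move/(coset_idr nCx); rewrite inE => /andP[].
Qed.

Lemma biprimary_sub_biprimary (gT : finGroupType) (A : {group gT}) :
  sigma_biprimary sigma A -> sigma_soluble sigma A -> sub_biprimary sigma A.
Proof.
move=> [i [j [neij ijA]]] solA; split.
  by apply: sigma_soluble_separable solA; [exact: sigma_prime | exact:
    sigma_cover].
exists i, j; split=> //; apply/pgroupP=> p pr_p pA.
have [k pk] := sigma_cover sigma_part pr_p.
have [|<-|<-] := (ijA k).1; rewrite ?inE /= ?pk ?orbT //.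
by exists p; rewrite // mem_primes pr_p cardG_gt0.
Qed.

Lemma biprimary_product_permutable (gT : finGroupType) (G : {group gT}) :
  section_of_biprimary_product sigma G -> Hall_permutable sigma G.
Proof.
case=> t [aT [A [Gs [R [_ bA sGsA nsRG isoG]]]]].
have resGs : residually_biprimary sigma Gs.
  move=> x xGs ntx.
  have [k ntxk] : exists k, x k != 1.
    apply/existsP; apply: contraR ntx => /existsPn x1; apply/eqP/ffunP=> k.
    by have := x1 k; rewrite negbK => /eqP->; rewrite ffunE.
  exists (aT k), (restrm_morphism (subsetT Gs) (dffun_morphism aT k));
    split=> //.
  apply: sub_biprimaryS (biprimary_sub_biprimary (bA k).1 (bA k).2).
  apply/subsetP=> _ /morphimP[y _ yGs ->].
  by have /setXnP := subsetP sGsA y yGs; apply.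
have sepGs := residually_biprimary_separable resGs.
have permGs := residually_Hall_permutable sigma_part resGs.
have nRG := normal_norm nsRG.
have permQ := morphim_Hall_permutable sigma_part nRG sepGs permGs.
have sepQ := quotient_sigma_separable nRG sepGs.
rewrite isog_sym in isoG; have /isogP[f _ defG] := isoG.
have -> : G = (f @* (Gs / R))%G by apply: group_inj; rewrite /= defG.
apply: (@morphim_Hall_permutable _ _ sigma_part _ _ (Gs / R)%G (Gs / R)%G f) =>
  //.
exact: permQ.
Qed.

(** In a nilpotent group the core prime to [sigma i] has [sigma i]-index, and it is proper when
    [sigma i] contains a prime divisor of the order. *)
Lemma abelian_sigma_separable (gT : finGroupType) (G : {group gT}) :
  abelian G -> sigma_separable sigma G.
Proof.
move=> abG H sHG ntH; have nilH := abelian_nil (abelianS sHG abG).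
have pr : prime (pdiv #|H|) by rewrite pdiv_prime // cardG_gt1.
have [i pi] := sigma_cover sigma_part pr.
exists 'O_(sigma i)^'(H)%G; last first.
  exists i; rewrite -divgS ?pcore_sub // -(dprod_card (nilpotent_pcoreC (sigma
    i) nilH)).
  by rewrite mulnK // -/(pgroup _ _) pcore_pgroup.
split; first exact: pcore_normal.
apply: contraTneq pi => defH.
have: (sigma i)^'.-group H by rewrite -defH pcore_pgroup.
by move/pgroupP/(_ _ pr (pdiv_dvd _)); rewrite inE.
Qed.

Lemma setX_sigma_separable (aT bT : finGroupType) (A : {group aT}) (B :
  {group bT}) :
  sigma_separable sigma A -> sigma_separable sigma B ->
  sigma_separable sigma (setX A B)%G.
Proof.
move=> sepA sepB; apply: residually_sigma_separable => x xAB ntx.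
have [nt1|/negPn/eqP x1] := boolP (x.1 != 1).
  exists aT, (restrm_morphism (subsetT _) (fst_morphism aT bT)); split=> //.
  apply: sigma_separableS sepA; apply/subsetP=> _ /morphimP[y _ yAB ->].
  by move: yAB; rewrite inE => /andP[].
exists bT, (restrm_morphism (subsetT _) (snd_morphism aT bT)); split.
  apply: contraNneq ntx => x2.
  by rewrite [x]surjective_pairing x1; have -> : x.2 = 1 := x2.
apply: sigma_separableS sepB; apply/subsetP=> _ /morphimP[y _ yAB ->].
by move: yAB; rewrite inE => /andP[].
Qed.

(* A direct factor of order pq makes both classes occur. *)
Lemma sub_biprimary_embed (gT : finGroupType) (P : {group gT}) :
  sub_biprimary sigma P ->
  exists (aT : finGroupType) (A : {group aT}) (f : {morphism [set: gT] >-> aT}),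
    [/\ 'injm f, f @* P \subset A, sigma_biprimary sigma A & sigma_soluble sigma
      A].
Proof.
move=> [sepP [i [j [neij ijP]]]].
have [p pi] := sigma_witness sigma_part i;
  have [q qj] := sigma_witness sigma_part j.
have pr_p := sigma_prime sigma_part pi; have pr_q := sigma_prime sigma_part qj.
pose C := Zp (p * q); have oC : #|C| = (p * q)%N.
  by rewrite card_Zp // muln_gt0 !prime_gt0.
have abC : abelian C := abelianS (subsetT C) (Zp_abelian _).
exists _, (setX P C)%G, (pairg1_morphism _ _); split.
- exact: injm_pairg1.
- apply/subsetP=> _ /morphimP[y _ yP ->]; apply/setXP; split=> //=;
  exact: group1.
- exists i, j; split=> // k; rewrite cardsX oC; split=> [[r rk]|].
    rewrite mem_primes => /and3P[pr_r _]; rewrite !Euclid_dvdM //.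
    rewrite (dvdn_prime2 pr_r pr_p) (dvdn_prime2 pr_r pr_q).
    case/or3P=> [rP|/eqP eqr|/eqP eqr].
    + have := pgroupP ijP r pr_r rP; rewrite inE /= => /orP[rij|rij];
      [left | right]; exact: (sigma_inj sigma_part) rk rij.
    + by left; apply: (sigma_inj sigma_part) rk _; rewrite eqr.
    by right; apply: (sigma_inj sigma_part) rk _; rewrite eqr.
  have gt0 : (0 < #|P| * (p * q))%N by rewrite !muln_gt0 cardG_gt0 !prime_gt0.
  case=> ->; [exists p | exists q]; rewrite //
    mem_primes gt0 ?pr_p ?pr_q /= mulnA.
    by rewrite mulnAC dvdn_mull.
  by rewrite dvdn_mull.
apply: (sigma_separable_soluble sigma_part); apply: setX_sigma_separable => //.
exact: abelian_sigma_separable.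
Qed.

(** One biprimary factor is taken for each element of [hT], with a homomorphism that does not kill
    it if it is a nontrivial element of [E]. Together these embed [E] in the product, and [f],
    carried along the embedding, presents [G] as a quotient. *)
Lemma covered_section (gT : finGroupType) (G : {group gT}) :
  (exists i j : I, i <> j) -> covered sigma G ->
    section_of_biprimary_product sigma G.
Proof.
move=> [i0 [j0 neij0]] [hT [E [f [fE resE]]]].
have resE' (x : hT) : exists (aT : finGroupType) (A : {group aT}) (g :
  {morphism E >-> aT}),
   [/\ x \in E -> g x = 1 -> x = 1, g @* E \subset A, sigma_biprimary sigma A
     & sigma_soluble sigma A].
  have [rT [g [gx bg]]] : exists (rT : finGroupType) (g : {morphism E >-> rT}),
      (x \in E -> g x = 1 -> x = 1) /\ sub_biprimary sigma (g @* E).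
    have [/andP[xE ntx]|ntx] := boolP ((x \in E) && (x != 1)).
      have [rT [g [ntgx bg]]] := resE x xE ntx; exists rT, g; split=> // _ gx1.
      by rewrite gx1 eqxx in ntgx.
    exists hT, (triv_morph hT E); split.
      by move=> xE _; apply/eqP; rewrite xE negbK in ntx.
    have triv1 : triv_morph hT E @* E = 1.
      by apply/trivgP/subsetP=> _ /morphimP[y _ _ ->]; rewrite inE.
    split; last by exists i0, j0; rewrite /= triv1 pgroup1.
    by apply: (@pgroup_sigma_separable _ _ _ _ i0); rewrite /= triv1 pgroup1.
  have [aT [A [h [injh sA bA solA]]]] := sub_biprimary_embed bg.
  have sE : E \subset g @*^-1 [set: rT] by rewrite -sub_morphim_pre ?subsetT.
  exists aT, A, (restrm_morphism sE (comp_morphism g h)); split=> //.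
    move=> xE /= hgx; apply: gx => //; apply: (injmP injh); rewrite ?inE //.
    by rewrite morph1.
  by rewrite morphim_restrm setIid morphim_comp.
pose t := #|hT|.
have [aT] := fin_all_exists (fun k : 'I_t => resE' (enum_val k)).
case/fin_all_exists=> A /fin_all_exists[g gP].
pose Phi (x : hT) : {dffun forall k, aT k} := [ffun k => g k x].
have PhiM : {in E &, {morph Phi : x y / x * y}}.
  by move=> x y xE yE; apply/ffunP=> k; rewrite !ffunE morphM.
pose PhiE := Morphism PhiM.
have injPhi : 'injm PhiE.
  apply/subsetP=> x; rewrite inE => /andP[xE]; rewrite !inE => /eqP Phi1.
  have [+ _ _ _] := gP (enum_rank x); rewrite enum_rankK => /(_ xE) gx.
  apply/eqP/gx; have := congr1 (fun u : {dffun forall k,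
    aT k} => u (enum_rank x)) Phi1.
  by rewrite /= !ffunE.
have sdom : PhiE @* E \subset (invm_morphism injPhi) @*^-1 E.
  by rewrite -sub_morphim_pre //= morphim_invm.
pose psi := restrm_morphism sdom (comp_morphism (invm_morphism injPhi) f).
exists t, aT, A, (PhiE @* E)%G, ('ker psi)%G; split.
- by apply/card_gt0P; exists (1 : hT).
- by move=> k; have [_ _ ? ?] := gP k.
- apply/subsetP=> _ /morphimP[x _ xE ->]; apply/setXnP=> k; rewrite ffunE.
  by have [_ /subsetP + _ _] := gP k; apply; rewrite mem_morphim.
- exact: ker_normal.
rewrite isog_sym; have := first_isog psi.
suff -> : psi @* (PhiE @* E) = G by [].
by rewrite morphim_restrm setIid morphim_comp morphim_invm.
Qed.

End Equivalences.

Theorem theoremD (I : Type) (sigma : I -> nat_pred)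
    (sigma_part : prime_partition sigma)
    (two_classes : exists i j : I, i <> j)
    (gT : finGroupType) (G : {group gT}) (solG : sigma_soluble sigma G) :
  [<-> (forall S : {set {group gT}},
          complete_Hall_sigma_set sigma G S -> sigma_basis sigma G S);
       chief_automizers_sigma_bounded sigma G;
       section_of_biprimary_product sigma G].
Proof.
have sepG : sigma_separable sigma G.
  apply: sigma_soluble_separable solG; first exact: sigma_prime.
  exact: sigma_cover.
split=> [basisG|]; last split=> [bG|secG S].
- apply: Hall_permutable_bounded => // i j X Y neij hallX hallY.
  (* Clause (i) speaks of whole Hall sets: nontrivial [X] and [Y] are placed in a common one, while
     a trivial subgroup permutes with everything. *)
  have [->|ntX] := eqVneq (X : {set gT}) 1; first by rewrite mul1g mulg1.
  have [->|ntY] := eqVneq (Y : {set gT}) 1; first by rewrite mul1g mulg1.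
  have [S [cS XS YS]] :=
    complete_Hall_sigma_set_extend sigma_part sepG neij ntX ntY hallX hallY.
  by have [_ permS] := basisG S cS; apply: permS.
- apply: (covered_section sigma_part two_classes).
  exact: bounded_covered two_classes sepG (chief_bounded_automizers sigma_part
    bG).
apply: Hall_permutable_basis => //.
exact: biprimary_product_permutable.
Qed.
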